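(* Let $G\equiv\mathbb R^n$ be a stratified group of step two, let $p>1$, let $\Omega\subset G$ be a bounded domain which is convex in the Euclidean sense, and let $d(g)$, $g\in\Omega$, be the Euclidean distance to the boundary $\partial\Omega$. Then: (i) $d$ is weakly $H$-concave in $\Omega$; (ii) $\Delta_{p,H}d\le0$ in the distributional sense in $\Omega$; (iii) the Hardy inequality $$\int_\Omega|\nabla_Hu|^p\,dg\ \ge\ \Big(\frac{p-1}{p}\Big)^p\int_\Omega\frac{|\nabla_Hd|^p}{d^p}\,|u|^p\,dg,\qquad u\in C_c^\infty(\Omega),$$ is valid.
   Context: A stratified group of step two is a connected, simply connected Lie group $G$ whose Lie algebra decomposes as $\mathfrak g=V_1\oplus V_2$ with $[V_1,V_1]=V_2$ and $[V_1,V_2]=\{0\}$. Let $m=\dim V_1<n=\dim\mathfrak g$. $G$ is identified with $\mathfrak g\cong\mathbb R^n$ via the exponential map, $\exp(g_1X_1+\dots+g_nX_n)=(g_1,\dots,g_n)$, where the basis $X_1,\dots,X_n$ of $\mathfrak g$ is adapted to the stratification ($X_1,\dots,X_m$ a basis of $V_1$). Writing $g=(g^{(1)},g^{(2)})\in\mathbb R^m\times\mathbb R^{n-m}$, the group law is $(g'g)_i=g_i+g_i'$ for $i\le m$ and $(g'g)_i=g_i+g'_i+\frac12\langle B^{(i)}g'^{(1)},g^{(1)}\rangle$ for $m<i\le n$, where the $B^{(i)}$ are $m\times m$ matrices (skew-symmetric in these coordinates). Dilations are $\delta_\lambda(g^{(1)},g^{(2)})=(\lambda g^{(1)},\lambda^2g^{(2)})$.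 The left-invariant fields $X_1,\dots,X_m$ are $X_j=\partial_j+\frac12\sum_{i=m+1}^n(B^{(i)}g^{(1)})_j\,\partial_i$; $\nabla_H=(X_1,\dots,X_m)$ is the horizontal gradient, $\mathrm{div}_H(f_1,\dots,f_m)=\sum_jX_jf_j$, and $\Delta_{p,H}u=\mathrm{div}_H(|\nabla_Hu|^{p-2}\nabla_Hu)$. The inequality $\Delta_{p,H}d\le0$ in the distributional sense means $\int_\Omega|\nabla_Hd|^{p-2}\langle\nabla_Hd,\nabla_H\varphi\rangle\,dg\ge0$ for all non-negative $\varphi\in C_c^\infty(\Omega)$. $dg$ is Lebesgue measure. The horizontal plane through $g\in G$ is $H_g=\{g\exp(v):v\in V_1\}$. For $g,g'\in G$ and $\lambda\in[0,1]$ put $g_\lambda=g\,\delta_\lambda(g^{-1}g')$. A function $u:\Omega\to\mathbb R$ is weakly $H$-concave in $\Omega$ if for all $g\in\Omega$, all $g'\in\Omega\cap H_g$ and all $\lambda\in[0,1]$ one has $u(g_\lambda)\ge(1-\lambda)u(g)+\lambda u(g')$ (here $g_\lambda\in\Omega$ because for $g'\in H_g$ one has $g_\lambda=(1-\lambda)g+\lambda g'$ and $\Omega$ is convex). *)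

(* Defs.v *)
From HB Require Import structures.
From mathcomp Require Import all_boot all_order all_algebra.
From mathcomp Require Import all_classical all_reals all_analysis.

Set Implicit Arguments.
Unset Strict Implicit.
Unset Printing Implicit Defensive.

Import Order.TTheory GRing.Theory Num.Theory.
Import numFieldNormedType.Exports.

Local Open Scope classical_set_scope.
Local Open Scope ring_scope.

(* The library norm on 'rV[R]_n is the sup norm; [enorm] is the Euclidean one. *)
Definition dotp (R : realType) (n : nat) (x y : 'rV[R]_n) : R :=
  \sum_i x 0 i * y 0 i.

Definition enorm (R : realType) (n : nat) (x : 'rV[R]_n) : R :=
  Num.sqrt (dotp x x).

Definition topo_boundary (T : topologicalType) (A : set T) : set T :=
  closure A `\` interior A.

Definition dist_boundary (R : realType) (n : nat) (Omega : set 'rV[R]_n)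
    (g : 'rV[R]_n) : R :=
  inf [set enorm (g - h) | h in topo_boundary Omega].

(* 'M[T]_(m, n) carries the sigma-algebra generated by the coordinates; for
   'rV[R]_n this is the Borel sigma-algebra. *)
Section measurable_matrix.
Context d (T : measurableType d) (m n : nat).

Definition mx_coord_sets : set (set 'M[T]_(m, n)) :=
  \bigcup_ij preimage_set_system setT
    (fun M : 'M[T]_(m, n) => M ij.1 ij.2) measurable.

Let mx_set0 : <<s mx_coord_sets >> set0.
Proof. exact: sigma_algebra0. Qed.

Let mx_setC A : <<s mx_coord_sets >> A -> <<s mx_coord_sets >> (~` A).
Proof. exact: sigma_algebraC. Qed.

Let mx_bigcup (F : (set 'M[T]_(m, n))^nat) :
  (forall i, <<s mx_coord_sets >> (F i)) ->
  <<s mx_coord_sets >> (\bigcup_i (F i)).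
Proof. exact: sigma_algebra_bigcup. Qed.

HB.instance Definition _ := @isMeasurable.Build d
  'M[T]_(m, n) <<s mx_coord_sets >> mx_set0 mx_setC mx_bigcup.

End measurable_matrix.

Section lebesgue_rV.
Context (R : realType).

Lemma measurable_mx_coord d (T : measurableType d) (m n : nat)
    (i : 'I_m) (j : 'I_n) :
  measurable_fun setT (fun M : 'M[T]_(m, n) => M i j).
Proof.
by move=> _ A mA; apply: sub_sigma_algebra; exists (i, j) => //; exists A.
Qed.

Lemma measurable_fun_mx d0 (S : measurableType d0) d (T : measurableType d)
    (m n : nat) (f : S -> 'M[T]_(m, n)) :
  (forall i j, measurable_fun setT (fun s => f s i j)) ->
  measurable_fun setT f.
Proof.
move=> mf; apply: (@measurability _ _ _ _ _ f (@mx_coord_sets _ T m n)) => //.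
move=> _ [_ [[i j] _ [A mA <-]] <-]; rewrite !setTI.
by have := mf i j measurableT A mA; rewrite setTI.
Qed.

Definition rV_cons (n : nat) (z : R * 'rV[R]_n) : 'rV[R]_n.+1 :=
  row_mx (z.1)%:M z.2.

Lemma rV_cons0 n z : @rV_cons n z 0 ord0 = z.1.
Proof.
have -> : ord0 = lshift n (ord0 : 'I_1) by exact/val_inj.
by apply: etrans (row_mxEl _ _ _ _) _; rewrite mxE mulr1n.
Qed.

Lemma rV_consS n z (j : 'I_n) : @rV_cons n z 0 (lift ord0 j) = z.2 0 j.
Proof.
have -> : lift ord0 j = rshift 1 j by exact/val_inj.
exact: row_mxEr.
Qed.

Lemma measurable_rV_cons n : measurable_fun setT (@rV_cons n).
Proof.
apply: measurable_fun_mx => i j; rewrite (ord1 i).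
have [j' ->|->] := unliftP ord0 j.
- under [X in measurable_fun _ X]funext do rewrite rV_consS.
  exact: (measurableT_comp (measurable_mx_coord _ _) measurable_snd).
- under [X in measurable_fun _ X]funext do rewrite rV_cons0.
  exact: measurable_fst.
Qed.

Definition rV_uncons (n : nat) (v : 'rV[R]_n.+1) : R * 'rV[R]_n :=
  (v 0 ord0, \row_j v 0 (lift ord0 j)).

Lemma rV_consK n : cancel (@rV_cons n) (@rV_uncons n).
Proof.
move=> [x v]; rewrite /rV_uncons rV_cons0; congr pair.
by apply/rowP => j; rewrite mxE rV_consS.
Qed.

Lemma rV_unconsK n : cancel (@rV_uncons n) (@rV_cons n).
Proof.
move=> v; apply/rowP => j; have [j' ->|->] := unliftP ord0 j.
  by rewrite rV_consS mxE.
by rewrite rV_cons0.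
Qed.

Lemma measurable_rV_uncons n : measurable_fun setT (@rV_uncons n).
Proof.
apply: measurable_fun_pair; first exact: measurable_mx_coord.
apply: measurable_fun_mx => i j.
under [X in measurable_fun _ X]funext do rewrite mxE.
exact: measurable_mx_coord.
Qed.

Section lebesgue_rV_succ.
Context (n : nat) (mu : {sigma_finite_measure set 'rV[R]_n -> \bar R}).

Definition lebesgue_rV_succ :=
  pushforward (@lebesgue_measure R \x mu)%E (@rV_cons n).

Let mf : measurable_fun setT (@rV_cons n) := @measurable_rV_cons n.

Let succ0 : lebesgue_rV_succ set0 = 0%E.
Proof. exact: measure0. Qed.

Let succ_ge0 A : (0 <= lebesgue_rV_succ A)%E.
Proof. exact: measure_ge0. Qed.

Let succ_sigma_additive : semi_sigma_additive lebesgue_rV_succ.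
Proof. exact: measure_semi_sigma_additive. Qed.

HB.instance Definition _ := isMeasure.Build _ _ _ lebesgue_rV_succ
  succ0 succ_ge0 succ_sigma_additive.

Let succ_sigma_finite : sigma_finite setT lebesgue_rV_succ.
Proof.
have /sigma_finiteP[F [TF ndF Foo]] := sigma_finiteT (@lebesgue_measure R).
have /sigma_finiteP[G [TG ndG Goo]] := sigma_finiteT mu.
exists (fun i => @rV_uncons n @^-1` (F i `*` G i)).
  rewrite -preimage_bigcup -[LHS](@preimage_setT _ _ (@rV_uncons n)).
  congr (_ @^-1` _); apply/seteqP; split => [[x v] _|//].
  have [i _ Fix] : (\bigcup_i F i) x by rewrite -TF.
  have [j _ Gjv] : (\bigcup_i G i) v by rewrite -TG.
  exists (maxn i j) => //; split => /=.
    by move: x Fix; exact/subsetPset/ndF/leq_maxl.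
  by move: v Gjv; exact/subsetPset/ndG/leq_maxr.
move=> i; have [mFi Fioo] := Foo i; have [mGi Gioo] := Goo i.
have mFG : measurable (F i `*` G i) by exact: measurableX.
split; first by rewrite -[X in measurable X]setTI; exact: measurable_rV_uncons.
rewrite /lebesgue_rV_succ /pushforward -comp_preimage.
rewrite (_ : _ \o _ = idfun) ?preimage_id; last exact/funext/rV_consK.
by rewrite product_measure1E// lte_mul_pinfty// ge0_fin_numE.
Qed.

HB.instance Definition _ := Measure_isSigmaFinite.Build _ _ _ lebesgue_rV_succ
  succ_sigma_finite.

End lebesgue_rV_succ.

Fixpoint lebesgue_rV (n : nat) : {sigma_finite_measure set 'rV[R]_n -> \bar R} :=
  match n with
  | 0 => \d_(0 : 'rV[R]_0)
  | n'.+1 => lebesgue_rV_succ (lebesgue_rV n')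
  end.

Lemma lebesgue_rV_box n (A : 'I_n -> set R) :
  (forall i, measurable (A i)) ->
  lebesgue_rV n [set x | forall i, A i (x 0 i)] =
  (\prod_(i < n) @lebesgue_measure R (A i))%E.
Proof.
elim: n A => [|n IH] A mA.
  rewrite big_ord0 /= diracE mem_set//= => -[].
  by [].
have mB : measurable [set x : 'rV[R]_n | forall i, A (lift ord0 i) (x 0 i)].
  rewrite (_ : mkset _ = \bigcap_(i in [set: 'I_n])
    ((fun x : 'rV[R]_n => x 0 i) @^-1` A (lift ord0 i))); last first.
    by apply/seteqP; split => x Ax i *; exact: Ax.
  apply: fin_bigcap_measurable => // i _; rewrite -[X in measurable X]setTI.
  exact: measurable_mx_coord.
rewrite big_ord_recl -IH//.
rewrite -(product_measure1E (@lebesgue_measure R) (lebesgue_rV n) (mA ord0) mB).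
rewrite [LHS]/(lebesgue_rV_succ _ _) /lebesgue_rV_succ /pushforward.
congr (_ _); apply/seteqP; split => [z Az|z [Az0 Az] i] /=.
  split => [|i]; first by have := Az ord0; rewrite /= rV_cons0.
  by have := Az (lift ord0 i); rewrite /= rV_consS.
by have [j ->|->] := unliftP ord0 i; rewrite ?rV_consS ?rV_cons0//; exact: Az.
Qed.

End lebesgue_rV.

Section smooth.
Context (R : realType) (n : nat).
Implicit Types (f : 'rV[R]_n -> R) (Omega : set 'rV[R]_n).

(* [partial i f x] is the junk value of [lim] where the limit does not exist. *)
Definition partial (i : 'I_n) f : 'rV[R]_n -> R := 'D_(delta_mx 0 i) f.

Definition smooth f : Prop := forall s : seq 'I_n,
  continuous (foldr partial f s) /\
  forall i x, derivable (foldr partial f s) x (delta_mx 0 i).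

Definition Ccinfty Omega f : Prop :=
  [/\ smooth f, compact (closure [set x | f x != 0]) &
      closure [set x | f x != 0] `<=` Omega].

Definition domain Omega : Prop :=
  [/\ open Omega, connected Omega & Omega !=set0].

End smooth.

(* A stratified Lie algebra of step two with dim V_1 = m and dim V_2 = k,
   written in an adapted basis: V_1 is spanned by the first m vectors of the
   standard basis of R^(m + k) and V_2 by the last k ones. *)
Section layers.
Context (R : realType) (m k : nat).

Definition layer1 : set 'rV[R]_(m + k) := [set v | rsubmx v = 0].
Definition layer2 : set 'rV[R]_(m + k) := [set v | lsubmx v = 0].

(* The linear span of {[v, w] | v in A, w in B}, for A stable under scaling. *)
Definition bracket_span (br : 'rV[R]_(m + k) -> 'rV[R]_(m + k) -> 'rV[R]_(m + k))
    (A B : set 'rV[R]_(m + k)) : set 'rV[R]_(m + k) :=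
  [set v | exists N (x y : 'I_N -> 'rV[R]_(m + k)),
    (forall a, A (x a) /\ B (y a)) /\ v = \sum_a br (x a) (y a)].

Record stratified2 := Stratified2 {
  bracket : 'rV[R]_(m + k) -> 'rV[R]_(m + k) -> 'rV[R]_(m + k) ;
  bracket_linearl : forall y, linear (bracket ^~ y) ;
  bracket_linearr : forall x, linear (bracket x) ;
  bracket_alt : forall x, bracket x x = 0 ;
  bracket_jacobi : forall x y z,
    bracket x (bracket y z) + bracket y (bracket z x) +
    bracket z (bracket x y) = 0 ;
  bracket_11 : bracket_span bracket layer1 layer1 = layer2 ;
  bracket_12 : bracket_span bracket layer1 layer2 = [set 0] ;
  layer2_nontrivial : (0 < k)%N
}.

End layers.

Section step_two_group.
Context (R : realType) (m k : nat) (G : stratified2 R m k).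
Local Notation n := (m + k)%N.
Implicit Types (g h v : 'rV[R]_n) (Omega : set 'rV[R]_n) (u : 'rV[R]_n -> R).

Let X1 (j : 'I_m) : 'rV[R]_n := delta_mx 0 (lshift k j).

(* <B^(i) x, y> is the coordinate m + i of the bracket [x, y], so that [gmul]
   below is the Baker-Campbell-Hausdorff product x + y + [x, y] / 2. *)
Definition structure_mx (i : 'I_k) : 'M[R]_m :=
  \matrix_(j, l) bracket G (X1 l) (X1 j) 0 (rshift m i).

(* B^(i) g^(1), as a row vector *)
Definition structure_act (i : 'I_k) g : 'rV[R]_m :=
  lsubmx g *m (structure_mx i)^T.

Definition gmul g h : 'rV[R]_n :=
  g + h +
  row_mx 0 (\row_(i < k) (2^-1 * dotp (structure_act i g) (lsubmx h))).

(* The inverse is -g because the B^(i) are skew-symmetric. *)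
Definition ginv g : 'rV[R]_n := - g.

Definition dilation (l : R) g : 'rV[R]_n :=
  row_mx (l *: lsubmx g) (l ^+ 2 *: rsubmx g).

(* exp is the identity map in exponential coordinates. *)
Definition horizontal_plane g : set 'rV[R]_n :=
  [set gmul g v | v in @layer1 R m k].

Definition gline g h (l : R) : 'rV[R]_n :=
  gmul g (dilation l (gmul (ginv g) h)).

Definition weakly_Hconcave Omega u : Prop :=
  forall g h l, Omega g -> (Omega `&` horizontal_plane g) h ->
    0 <= l <= 1 -> (1 - l) * u g + l * u h <= u (gline g h l).

Definition Xfield (j : 'I_m) u g : R :=
  partial (lshift k j) u g +
  2^-1 * \sum_(i < k) structure_act i g 0 j * partial (rshift m i) u g.

Definition gradH u g : 'rV[R]_m := \row_j Xfield j u g.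

(* For p < 2 the factor |grad u|^(p-2) is read as 0 where grad u = 0. *)
Definition pLaplacianH_le0 (p : R) Omega u : Prop :=
  forall phi, Ccinfty Omega phi -> (forall g, 0 <= phi g) ->
    (0 <= \int[lebesgue_rV R n]_(g in Omega)
      (enorm (gradH u g) `^ (p - 2) * dotp (gradH u g) (gradH phi g))%:E)%E.

End step_two_group.

(* Main.v *)
Require Import Defs.
From mathcomp Require Import all_boot all_order all_algebra.
From mathcomp Require Import all_classical all_reals all_analysis.
From mathcomp Require Import measurable_realfun ring lra.
Set Implicit Arguments.
Unset Strict Implicit.
Unset Printing Implicit Defensive.
Import Order.TTheory GRing.Theory Num.Theory.
Import numFieldNormedType.Exports.
Local Open Scope classical_set_scope.
Local Open Scope ring_scope.

(** The distance d to the boundary of a convex domain is concave and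
    1-Lipschitz, and the integral curves of a left-invariant horizontal field
    X_v are straight lines on which v -> g exp(tv) is affine; this gives (i).
    For (ii), the one-sided derivative X_v d is nonincreasing along the flow of
    X_v, hence so is |X_v d|^(p-2) X_v d, and since the flow preserves Lebesgue
    measure, testing against difference quotients of phi >= 0 yields
    int |X_v d|^(p-2) X_v d X_v phi >= 0 for every single direction v.  The
    average of |<xi, v>|^(p-2) <xi, v> <eta, v> over v in the unit ball of R^m is
    invariant under reflections, hence a positive multiple of
    |xi|^(p-2) <xi, eta>, so averaging over v gives the full p-Laplacian.  A
    concave function has a linear derivative almost everywhere, which makes
    (grad_H d) represent the one-sided derivatives.  For (iii) the same argument
    is run with phi = |u|^p / d^(p-1), and combined with the pointwise tangent
    inequality of the convex function s^p. *)

(** * Maps preserving Lebesgue measure *)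

(** The obstacle is regularity: d is only concave and Lipschitz, and [partial] is a default value
    wherever its limit fails to exist, so there is no second derivative to integrate by parts. The
    right derivative [rderive] exists at every point of Omega in every direction, and its
    monotonicity along straight lines replaces the sign of a Hessian. For p different from 2 the
    p-Laplacian is not the sum of its one-dimensional analogues in the directions X_j, whence the
    average over all v. The test function |u|^p / d^(p-1) is not smooth either, so the testing
    lemmas ask only for a Lipschitz function whose right difference quotients converge. That left
    and right derivatives of d agree almost everywhere comes from the same transport argument, run
    along translations: the left derivative at x is at most the right derivative at x - t e, and
    moving by t changes a weighted integral only by O(t). The constant (p-1)/p is the scale s for
    which Young's inequality at s |grad_H d| |u| / d makes the leftover terms cancel exactly. *)

Section lebesgue_invariance.
Context {R : realType}.

Lemma lebesgue_measure_sign_shift (e : bool) (c : R) (A : set R) :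
  measurable A ->
  lebesgue_measure [set s : R | A ((-1) ^+ e * s + c)] = lebesgue_measure A.
Proof.
have shift (B : set R) b : measurable B ->
    lebesgue_measure [set s : R | B (s + b)] = lebesgue_measure B.
  move=> mB; have mf : measurable_fun setT (fun s : measurableTypeR R => s + b).
    exact: measurable_funD.
  rewrite -[LHS]/(pushforward lebesgue_measure (fun s : measurableTypeR R => s + b : measurableTypeR R) B).
  apply/esym; apply: lebesgue_measure_unique => //= _ [[a d]] _ <-.
  rewrite /pushforward.
  rewrite (_ : _ @^-1` _ = `](a - b), (d - b)]%classic); last first.
    apply/seteqP; split => s /=; rewrite !in_itv/= => /andP[? ?].
      by apply/andP; split; lra.
    by apply/andP; split; lra.
  by rewrite !lebesgue_measure_itv/= !lte_fin ltrD2r -!EFinB; case: ifP => // _; congr EFin; ring.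
move=> mA; have mN : measurable [set s : R | A (- s)].
  by rewrite -[X in measurable X]setTI; exact: (@oppr_measurable R).
case: e => /=; last first.
  by under eq_set do rewrite expr0 mul1r; exact: shift.
rewrite -[RHS]lebesgue_measureN// /pushforward.
rewrite -(shift _ (- c) mN); congr (lebesgue_measure _).
by apply/seteqP; split => s /=; rewrite expr1 mulN1r opprD opprK.
Qed.

(** The product measure integrates x-sections by definition; Tonelli for indicator functions gives
    this other slicing, in which the first coordinate moves. *)
Lemma product_measure_ysection d1 d2 (T1 : measurableType d1)
    (T2 : measurableType d2) (m1 : {sigma_finite_measure set T1 -> \bar R})
    (m2 : {sigma_finite_measure set T2 -> \bar R}) (A : set (T1 * T2)) :
  measurable A -> (m1 \x m2)%E A = (\int[m2]_y m1 (ysection A y))%E.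
Proof.
move=> mA; have := indic_fubini_tonelli m1 m2 mA.
by rewrite indic_fubini_tonelli_FE// indic_fubini_tonelli_GE.
Qed.

Lemma measurable_rV_map n (T : 'rV[R]_n -> 'rV[R]_n) (A : set 'rV[R]_n) :
  measurable_fun setT T -> measurable A -> measurable (T @^-1` A).
Proof. by move=> mT mA; rewrite -[X in measurable X]setTI; exact: mT. Qed.

(** One statement covers shears and reflections in a single coordinate i. Since [lebesgue_rV] splits
    off coordinate 0, the induction freezes that coordinate when i is another one; when i is
    coordinate 0 it freezes all the others and uses the invariance of one-dimensional Lebesgue
    measure. *)
Lemma lebesgue_rV_coord n (i : 'I_n) (e : bool) (f : 'rV[R]_n -> R)
    (T : 'rV[R]_n -> 'rV[R]_n) :
  measurable_fun setT T ->
  (forall x j, j != i -> T x 0 j = x 0 j) ->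
  (forall x, T x 0 i = (-1) ^+ e * x 0 i + f x) ->
  (forall x y : 'rV[R]_n, (forall j, j != i -> x 0 j = y 0 j) -> f x = f y) ->
  forall A, measurable A -> lebesgue_rV R n (T @^-1` A) = lebesgue_rV R n A.
Proof.
elim: n i e f T => [[]//|n IH] i e f T mT Tj Ti fE A mA.
rewrite /= [LHS]/(lebesgue_rV_succ _ _) /lebesgue_rV_succ /pushforward.
have mc B : measurable B -> measurable (@rV_cons R n @^-1` B).
  by move=> mB; rewrite -[X in measurable X]setTI; exact: measurable_rV_cons.
have mTA : measurable (T @^-1` A) by exact: measurable_rV_map.
have [i' ei|ei] := unliftP ord0 i.
- apply: eq_integral => s _ /=.
  pose Ts v := (rV_uncons (T (rV_cons (s, v)))).2.
  have TsE v : T (rV_cons (s, v)) = rV_cons (s, Ts v).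
    rewrite -[LHS]rV_unconsK; congr rV_cons; rewrite /Ts /rV_uncons/=.
    by rewrite Tj ?ei// rV_cons0.
  have mconss : measurable_fun setT (fun v : 'rV[R]_n => rV_cons (s, v)).
    by apply: measurableT_comp; [exact: measurable_rV_cons|exact: pair1_measurable].
  have mTs : measurable_fun setT Ts.
    apply: measurableT_comp; first exact: measurable_snd.
    apply: measurableT_comp; first exact: measurable_rV_uncons.
    exact: measurableT_comp.
  have -> : xsection (rV_cons (n:=n) @^-1` (T @^-1` A)) s =
      Ts @^-1` (xsection (rV_cons (n:=n) @^-1` A) s).
    apply/seteqP; split => v /=; rewrite !xsectionE/= TsE; exact.
  apply: (IH i' e (fun v => f (rV_cons (s, v)))) => //.
  + move=> v j ji; rewrite /Ts /rV_uncons/= mxE Tj ?rV_consS//.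
    by rewrite ei (inj_eq lift_inj).
  + by move=> v; rewrite /Ts /rV_uncons/= mxE -ei Ti {1}ei rV_consS.
  + move=> v w vw; apply: fE => j; rewrite ei.
    have [j' ->|->] := unliftP ord0 j; last by rewrite !rV_cons0.
    by rewrite (inj_eq lift_inj) !rV_consS; exact: vw.
  + by apply: measurable_xsection; exact: mc.
- rewrite !product_measure_ysection; [|exact: mc..].
  apply: eq_integral => v _ /=.
  (* The offset f does not see coordinate 0, so it may be evaluated with 0 in that place. *)
  rewrite -[RHS](lebesgue_measure_sign_shift e (f (rV_cons (0, v))));
    last by apply: measurable_ysection; exact: mc.
  congr (lebesgue_measure _); apply/seteqP; split => s; rewrite ?ysectionE/= ?ysectionE/=;
  (have -> : T (rV_cons (s, v)) = rV_cons ((-1) ^+ e * s + f (rV_cons (0, v)), v); last exact);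
  apply/rowP => j; (have [j' ->|->] := unliftP ord0 j;
     first by rewrite Tj ?ei// !rV_consS);
  rewrite -ei Ti ei !rV_cons0 /=; congr (_ + _);
  apply: fE => j'; rewrite ei; (have [j1 ->|->] := unliftP ord0 j' => //);
  by rewrite !rV_consS.
Qed.

Definition rV_preserving n (T : 'rV[R]_n -> 'rV[R]_n) :=
  measurable_fun setT T /\
  forall A, measurable A -> lebesgue_rV R n (T @^-1` A) = lebesgue_rV R n A.

Lemma rV_preserving_comp n (S T : 'rV[R]_n -> 'rV[R]_n) :
  rV_preserving S -> rV_preserving T -> rV_preserving (S \o T).
Proof.
move=> [mS SE] [mT TE]; split; first exact: measurableT_comp.
move=> A mA; rewrite comp_preimage TE ?SE//.
exact: measurable_rV_map.
Qed.

(** The coordinates in S are updated one at a time. F reads only coordinates outside S, so the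
    earlier updates do not alter the later increments. *)
Lemma rV_preserving_shear n (S : {set 'I_n}) (F : 'rV[R]_n -> 'rV[R]_n) :
  (forall j, measurable_fun setT (fun x => F x 0 j)) ->
  (forall x j, j \notin S -> F x 0 j = 0) ->
  (forall x y : 'rV[R]_n, (forall j, j \notin S -> x 0 j = y 0 j) -> F x = F y) ->
  rV_preserving (fun x => x + F x).
Proof.
move=> mF F0 FE.
pose Ts (s : seq 'I_n) (x : 'rV[R]_n) := \row_j (x 0 j + (if j \in s then F x 0 j else 0)).
suff H s : {subset s <= S} -> rV_preserving (Ts s).
  rewrite (_ : (fun x => _) = Ts (enum S)).
    by apply: H => j; rewrite mem_enum.
  apply/funext => x; apply/rowP => j; rewrite !mxE mem_enum.
  by case: ifPn => // jS; rewrite F0.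
have mcoord (j : 'I_n) : measurable_fun setT (fun x : 'rV[R]_n => x 0 j).
  exact: measurable_mx_coord.
elim: s => [_|i s IH sS].
  rewrite (_ : Ts _ = id); last first.
    by apply/funext => x; apply/rowP => j; rewrite !mxE addr0.
  by split => //; exact: measurable_id.
have {}IH : rV_preserving (Ts s) by apply: IH => j js; apply: sS; rewrite inE js orbT.
have iS : i \in S by apply: sS; rewrite inE eqxx.
have [si|si] := boolP (i \in s).
  rewrite (_ : Ts _ = Ts s)//; apply/funext => x; apply/rowP => j; rewrite !mxE inE.
  by case: eqP => // ->; rewrite si.
pose C (x : 'rV[R]_n) : 'rV[R]_n := \row_j (x 0 j + (if j == i then F x 0 i else 0)).
have -> : Ts (i :: s) = C \o Ts s.
  apply/funext => x; apply/rowP => j; rewrite !mxE inE /=.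
  have -> : F (Ts s x) = F x.
    apply: FE => l lS; rewrite mxE; case: ifPn => [ls|]; last by rewrite addr0.
    by move: lS; rewrite sS// inE ls orbT.
  case: eqP => [->|_] /=; last by rewrite addr0.
  by rewrite (negbTE si) addr0.
apply: rV_preserving_comp => //.
have mC : measurable_fun setT C.
  apply: measurable_fun_mx => i0 j; rewrite (ord1 i0).
  under [X in measurable_fun _ X]funext do rewrite mxE.
  by apply: measurable_funD => //; case: (j == i).
split => //; apply: (@lebesgue_rV_coord n i false (fun x => F x 0 i)) => //.
- by move=> x j ji; rewrite mxE (negbTE ji) addr0.
- by move=> x; rewrite mxE eqxx expr0 mul1r.
- move=> x y xy; congr (fun_of_matrix _ _ _); apply: FE => j jS; apply: xy.
  by apply: contra jS => /eqP ->.
Qed.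

Lemma rV_preserving_flip n (i : 'I_n) :
  rV_preserving (fun x : 'rV[R]_n => \row_j ((-1) ^+ (j == i) * x 0 j)).
Proof.
have mC : measurable_fun setT (fun x : 'rV[R]_n => \row_j ((-1) ^+ (j == i) * x 0 j)).
  apply: measurable_fun_mx => i0 j; rewrite (ord1 i0).
  under [X in measurable_fun _ X]funext do rewrite mxE.
  by apply: measurable_funM => //; exact: measurable_mx_coord.
split => //; apply: (@lebesgue_rV_coord n i true (fun=> 0)) => //.
- by move=> x j ji; rewrite mxE (negbTE ji) expr0 mul1r.
- by move=> x; rewrite mxE eqxx addr0.
Qed.

Lemma rV_preserving_translate n (c : 'rV[R]_n) : rV_preserving (fun x => x + c).
Proof.
apply: (@rV_preserving_shear n [set: 'I_n]%SET (fun=> c)) => // x j.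
by rewrite inE.
Qed.

Definition householder n (w x : 'rV[R]_n) : 'rV[R]_n := x - (2 * dotp x w) *: w.

Lemma measurable_dotp n (w : 'rV[R]_n) : measurable_fun setT (fun x => dotp x w).
Proof.
apply: measurable_sum => j; apply: measurable_funM => //.
exact: measurable_mx_coord.
Qed.

(* Diagonalise by a shear making <x, w> / w_i the i-th coordinate. *)
Lemma rV_preserving_householder n (w : 'rV[R]_n) :
  dotp w w = 1 -> rV_preserving (householder w).
Proof.
move=> w1; have [i wi0] : exists i, w 0 i != 0.
  apply/not_existsP => w0; move: w1; rewrite /dotp big1 => [/esym/eqP|j _].
    by rewrite oner_eq0.
  by have /negP := w0 j; rewrite negbK => /eqP ->; rewrite mul0r.
have dotpE x : dotp x w = x 0 i * w 0 i + \sum_(j | j != i) x 0 j * w 0 j.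
  by rewrite /dotp (bigD1 i).
pose q (x : 'rV[R]_n) : R := (\sum_(j | j != i) x 0 j * w 0 j) / w 0 i.
have mq : measurable_fun setT q.
  apply: measurable_funM => //.
  have -> : (fun x : 'rV[R]_n => \sum_(j | j != i) x 0 j * w 0 j) =
      (fun x => dotp x w - x 0 i * w 0 i).
    by apply/funext => x; rewrite dotpE; ring.
  apply: measurable_funB; first exact: measurable_dotp.
  by apply: measurable_funM => //; exact: measurable_mx_coord.
have pP (e : R) : rV_preserving (fun x => x + (e * q x) *: delta_mx 0 i).
  apply: (@rV_preserving_shear n [set i]%SET) => [j|x j|x y xy].
  - under [X in measurable_fun _ X]funext do rewrite !mxE.
    by apply: measurable_funM => //; apply: measurable_funM.
  - by rewrite inE => ji; rewrite !mxE (negbTE ji) andbF mulr0.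
  - congr ((_ * (_ / _)) *: _); apply: eq_bigr => j ji.
    by rewrite xy// inE.
pose F (x : 'rV[R]_n) : 'rV[R]_n :=
  \row_j (if j == i then 0 else - 2 * w 0 i * w 0 j * x 0 i).
have pF : rV_preserving (fun x => x + F x).
  apply: (@rV_preserving_shear n (~: [set i])%SET) => [j|x j|x y xy].
  - rewrite (_ : (fun x => F x 0 j) = fun x =>
        if j == i then 0 else - 2 * w 0 i * w 0 j * x 0 i); last first.
      by apply/funext => x; rewrite mxE.
    by case: (j == i) => //; apply: measurable_funM => //; exact: measurable_mx_coord.
  - by rewrite !inE negbK mxE => ->.
  - by apply/rowP => j; rewrite !mxE (xy i)// !inE eqxx.
(* After the first shear the i-th coordinate is <x, w> / w_i. The reflection then subtracts 2 <x, w>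
   w_j from each other coordinate, which is the shear by F, and negates the i-th one; the last
   factor undoes the first shear. *)
have -> : householder w = (fun x => x + ((-1) * q x) *: delta_mx 0 i) \o
    (fun x : 'rV[R]_n => \row_j ((-1) ^+ (j == i) * x 0 j)) \o
    (fun x => x + F x) \o (fun x => x + (1 * q x) *: delta_mx 0 i).
  apply/funext => x; apply/rowP => j; rewrite /=.
  set y := x + (1 * q x) *: _.
  have yj l : l != i -> y 0 l = x 0 l.
    by move=> li; rewrite !mxE (negbTE li) andbF mulr0 addr0.
  have yi : y 0 i * w 0 i = dotp x w.
    rewrite !mxE !eqxx mulr1 mul1r dotpE mulrDl; congr +%R.
    by rewrite /q divfK.
  clearbody y; set z := (\row_j _).
  have zj l : l != i -> z 0 l = x 0 l - 2 * w 0 l * dotp x w.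
    by move=> li; rewrite !mxE (negbTE li) expr0 mul1r -yi yj //; ring.
  have zi : z 0 i = - y 0 i by rewrite !mxE !eqxx addr0 expr1 mulN1r.
  clearbody z.
  rewrite [LHS]mxE [in RHS]mxE.
  have [->|ji] := eqVneq j i; last first.
    by rewrite zj// !mxE (negbTE ji) andbF mulr0 addr0; ring.
  have qz : q z = (dotp x w - x 0 i * w 0 i - 2 * dotp x w * (1 - w 0 i ^+ 2)) / w 0 i.
    rewrite /q; congr (_ / _).
    rewrite (eq_bigr (fun l => x 0 l * w 0 l - 2 * dotp x w * (w 0 l * w 0 l))); last first.
      by move=> l li; rewrite zj//; ring.
    rewrite big_split/= sumrN -mulr_sumr -w1 (dotpE w).
    by rewrite [in X in X - _ - _](dotpE x); ring.
  rewrite zi !mxE !eqxx qz mulr1.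
  have -> : y 0 i = dotp x w / w 0 i by rewrite -yi mulfK.
  by field.
apply: rV_preserving_comp => //; apply: rV_preserving_comp => //.
by apply: rV_preserving_comp => //; exact: rV_preserving_flip.
Qed.

End lebesgue_invariance.

(** * Euclidean inner product and norm, and measurability of open sets *)

Section euclidean.
Context {R : realType} {n : nat}.
Implicit Types (x y z : 'rV[R]_n) (a e : R).

Lemma dotpC x y : dotp x y = dotp y x.
Proof. by apply: eq_bigr => i _; rewrite mulrC. Qed.

Lemma dotpDl x y z : dotp (x + y) z = dotp x z + dotp y z.
Proof. by rewrite -big_split; apply: eq_bigr => i _; rewrite mxE mulrDl. Qed.

Lemma dotpZl a x y : dotp (a *: x) y = a * dotp x y.
Proof. by rewrite mulr_sumr; apply: eq_bigr => i _; rewrite mxE mulrA. Qed.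

Lemma dotpNl x y : dotp (- x) y = - dotp x y.
Proof. by rewrite -scaleN1r dotpZl mulN1r. Qed.

Lemma dotpDr x y z : dotp x (y + z) = dotp x y + dotp x z.
Proof. by rewrite ![dotp x _]dotpC dotpDl. Qed.

Lemma dotpZr a x y : dotp x (a *: y) = a * dotp x y.
Proof. by rewrite ![dotp x _]dotpC dotpZl. Qed.

Lemma dotpNr x y : dotp x (- y) = - dotp x y.
Proof. by rewrite ![dotp x _]dotpC dotpNl. Qed.

Lemma dotp0l x : dotp 0 x = 0.
Proof. by rewrite -(scale0r x) dotpZl mul0r. Qed.

Lemma dotp0r x : dotp x 0 = 0.
Proof. by rewrite dotpC dotp0l. Qed.

Lemma dotp_delta (i : 'I_n) x : dotp x (delta_mx 0 i) = x 0 i.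
Proof.
rewrite /dotp (bigD1 i)//= !mxE !eqxx mulr1 big1 ?addr0// => j ji.
by rewrite mxE (negbTE ji) andbF mulr0.
Qed.

Lemma dotp_ge0 x : 0 <= dotp x x.
Proof. by apply: sumr_ge0 => i _; rewrite -expr2 sqr_ge0. Qed.

Lemma enorm_ge0 x : 0 <= enorm x.
Proof. exact: sqrtr_ge0. Qed.

Lemma sqr_enorm x : enorm x ^+ 2 = dotp x x.
Proof. by rewrite sqr_sqrtr// dotp_ge0. Qed.

Lemma enormZ a x : enorm (a *: x) = `|a| * enorm x.
Proof.
by rewrite /enorm dotpZl dotpZr mulrA -expr2 sqrtrM ?sqr_ge0// sqrtr_sqr.
Qed.

Lemma enormN x : enorm (- x) = enorm x.
Proof. by rewrite -scaleN1r enormZ normrN1 mul1r. Qed.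

Lemma enormB x y : enorm (x - y) = enorm (y - x).
Proof. by rewrite -enormN opprB. Qed.

Lemma enorm0 : enorm (0 : 'rV[R]_n) = 0.
Proof. by rewrite /enorm dotp0l sqrtr0. Qed.

Lemma coord_le_enorm x i : `|x 0 i| <= enorm x.
Proof.
rewrite -sqrtr_sqr ler_wsqrtr// /dotp (bigD1 i)//= -expr2 lerDl.
by apply: sumr_ge0 => j _; rewrite -expr2 sqr_ge0.
Qed.

Lemma enorm_eq0 x : enorm x = 0 -> x = 0.
Proof.
move=> x0; apply/rowP => i; rewrite mxE; apply/eqP; rewrite -normr_le0 -x0.
exact: coord_le_enorm.
Qed.

Lemma norm_le_enorm x : `|x| <= enorm x.
Proof.
rewrite [X in X <= _]mx_normrE; apply: bigmax_le => [|[i j] _]; first exact: enorm_ge0.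
by rewrite (ord1 i); exact: coord_le_enorm.
Qed.

Lemma coord_le_norm x i : `|x 0 i| <= `|x|.
Proof.
rewrite [leRHS]mx_normrE.
exact: (le_bigmax _ (fun ij => `|x ij.1 ij.2|) (ord0, i)).
Qed.

Lemma dotp_le_enorm x y : `|dotp x y| <= enorm x * enorm y.
Proof.
have [->|y0] := eqVneq y 0; first by rewrite dotp0r normr0 enorm0 mulr0.
have yy : 0 < dotp y y.
  rewrite lt_neqAle dotp_ge0 andbT eq_sym; apply: contra y0 => /eqP y0.
  by apply/eqP/enorm_eq0; rewrite /enorm y0 sqrtr0.
rewrite -ler_sqr ?nnegrE ?mulr_ge0 ?enorm_ge0// exprMn !sqr_enorm real_normK ?num_real//.
have := dotp_ge0 (dotp y y *: x - dotp x y *: y).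
rewrite dotpDl !dotpDr !dotpNl !dotpNr !dotpZl !dotpZr (dotpC y x).
rewrite (_ : _ + _ = dotp y y * (dotp x x * dotp y y - dotp x y ^+ 2)); last by ring.
by rewrite pmulr_rge0// subr_ge0.
Qed.

Lemma ler_enormD x y : enorm (x + y) <= enorm x + enorm y.
Proof.
rewrite -ler_sqr ?nnegrE ?addr_ge0 ?enorm_ge0// sqr_enorm dotpDl !dotpDr.
rewrite -!sqr_enorm (dotpC y x) sqrrD.
have := le_trans (ler_norm _) (dotp_le_enorm x y); lra.
Qed.

Lemma enorm_delta (i : 'I_n) : enorm (delta_mx 0 i : 'rV[R]_n) = 1.
Proof. by rewrite /enorm dotp_delta mxE !eqxx sqrtr1. Qed.

Lemma enorm_le_sum x : enorm x <= \sum_i `|x 0 i|.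
Proof.
rewrite {1}(row_sum_delta x); elim/big_ind2 : _ => [|a b c d ab cd|i _].
- by rewrite enorm0.
- by apply: le_trans (ler_enormD _ _) _; exact: lerD.
- by rewrite enormZ enorm_delta mulr1.
Qed.

Lemma enorm_le_norm x : enorm x <= n%:R * `|x|.
Proof.
apply: le_trans (enorm_le_sum x) _.
rewrite -[n in n%:R]card_ord -sumr_const mulr_suml ler_sum// => i _.
by rewrite mul1r coord_le_norm.
Qed.

Lemma lipschitz_continuous_rV (f : 'rV[R]_n -> R) (C : R) :
  (forall x y, `|f x - f y| <= C * enorm (x - y)) -> continuous f.
Proof.
move=> fC x; apply/(@cvgrPdist_le _ _ _ (nbhs x) _ f) => e e0.
have C0 : 0 < `|C| * n%:R + 1 by rewrite ltr_wpDl// mulr_ge0.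
near=> y; apply: le_trans (fC _ _) _.
apply: (@le_trans _ _ (`|C| * (n%:R * `|x - y|))).
  apply: le_trans (ler_wpM2l (normr_ge0 C) (enorm_le_norm _)).
  by apply: ler_wpM2r; [exact: enorm_ge0|exact: ler_norm].
apply: (@le_trans _ _ ((`|C| * n%:R + 1) * `|x - y|)).
  by rewrite mulrA ler_wpM2r// lerDl.
rewrite -ler_pdivlMl//; near: y.
by apply: cvgr_dist_le; [exact: cvg_id|rewrite mulr_gt0// invr_gt0].
Unshelve. all: by end_near. Qed.

Lemma open_enorm (U : set 'rV[R]_n) x : open U -> U x ->
  exists2 e, 0 < e & forall y, enorm (x - y) < e -> U y.
Proof.
move=> oU Ux; have /nbhs_ballP[e /= e0 eU] := open_nbhs_nbhs (conj oU Ux).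
exists e => // y xy; apply: eU; rewrite mx_norm_ball /ball_/=.
by apply: le_lt_trans (norm_le_enorm _) xy.
Qed.

(** The sigma-algebra is generated by the coordinates, so an open set has to be written as a
    countable union of boxes: cubes with rational centre and radius 1/(i+1) suffice. *)
Lemma open_measurable_rV (U : set 'rV[R]_n) : open U -> measurable U.
Proof.
move=> oU.
pose rv (q : 'rV[rat]_n) : 'rV[R]_n := map_mx ratr q.
pose B (i : 'rV[rat]_n * nat) := [set y : 'rV[R]_n | forall j, `|rv i.1 0 j - y 0 j| < i.2.+1%:R^-1].
have mB i : measurable (B i).
  rewrite (_ : B i = \bigcap_(j in [set: 'I_n])
    ((fun x : 'rV[R]_n => x 0 j) @^-1` [set s | `|rv i.1 0 j - s| < i.2.+1%:R^-1])); last first.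
    by apply/seteqP; split => [x Ax j _|x Ax j]; exact: Ax.
  apply: fin_bigcap_measurable => // j _; rewrite -[X in measurable X]setTI.
  apply: measurable_mx_coord => //.
  have -> : [set s : R | `|rv i.1 0 j - s| < i.2.+1%:R^-1] = ball (rv i.1 0 j) i.2.+1%:R^-1.
    by apply/seteqP; split => s /=; rewrite -ball_normE.
  exact: measurable_ball.
rewrite (_ : U = \bigcup_i (if `[< B i `<=` U >] then B i else set0)).
  by apply: countable_bigcupT_measurable => [|i]; [exact: countableP|case: ifP].
apply/seteqP; split => [x Ux|x [i _]]; last by case: ifPn => // /asboolP; exact.
have /nbhs_ballP[e /= e0 eU] := open_nbhs_nbhs (conj oU Ux).
(* Half of e, because the cube is centred near x and not at x: both x and any point of the cube are
   within the radius of the centre. *)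
have [k ke] : exists k, k.+1%:R^-1 < e / 2 :> R.
  have := @cvg_harmonic R; move/cvgrPdist_lt => /(_ (e / 2)).
  rewrite divr_gt0// => /(_ isT)[N _ /(_ N)] /= /(_ (leqnn _)) H; exists N.
  by move: H; rewrite sub0r normrN ger0_norm.
have /choice[q qx] : forall j, exists q : rat, `|ratr q - x 0 j| < k.+1%:R^-1.
  move=> j; have xx : x 0 j - k.+1%:R^-1 < x 0 j + k.+1%:R^-1.
    by rewrite ltrD2l; apply: (@lt_trans _ _ 0); rewrite ?oppr_lt0 ?invr_gt0.
  have [q] := rat_in_itvoo xx; rewrite in_itv/= => /andP[q1 q2]; exists q.
  move: (k.+1%:R^-1) q1 q2 => t ? ?; by rewrite ltr_norml; apply/andP; split; lra.
exists (\row_j q j, k) => //; case: ifPn => [_ j|/asboolP[y By]].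
  by rewrite !mxE.
apply: eU; split => // i j; rewrite (ord1 i) -ball_normE /ball_/=.
have := qx j; have := By j; rewrite !mxE /= => yq xq.
rewrite (_ : _ - _ = (x 0 j - ratr (q j)) + (ratr (q j) - y 0 j)); last by ring.
apply: le_lt_trans (ler_normD _ _) _; rewrite (distrC (x 0 j)).
by move: (k.+1%:R^-1) yq xq ke => t ? ? ?; lra.
Qed.

Lemma measurable_box (A : 'I_n -> set R) : (forall i, measurable (A i)) ->
  measurable [set x : 'rV[R]_n | forall i, A i (x 0 i)].
Proof.
move=> mA; rewrite (_ : mkset _ = \bigcap_(i in [set: 'I_n])
    ((fun x : 'rV[R]_n => x 0 i) @^-1` A i)); last first.
  by apply/seteqP; split => x Ax i *; exact: Ax.
apply: fin_bigcap_measurable => // i _; rewrite -[X in measurable X]setTI.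
exact: measurable_mx_coord.
Qed.

Lemma continuous_measurable_rV (D : set 'rV[R]_n) (f : 'rV[R]_n -> R) :
  open D -> (forall x, D x -> {for x, continuous f}) -> measurable_fun D f.
Proof.
move=> oD cf; apply: (measurability _ (RGenOpens.measurableE R)).
move=> _ [_ [a [b ->] <-]]; apply: open_measurable_rV.
rewrite openE => x [Dx fx]; apply: filterI; first exact: open_nbhs_nbhs.
by apply: cf => //; apply: open_nbhs_nbhs; split => //; exact: interval_open.
Qed.

End euclidean.

(** * Distance to the boundary of a convex domain *)

Section dist_boundary.
Context {R : realType} {n : nat} {Omega : set 'rV[R]_n}.
Hypotheses (n0 : (0 < n)%N) (oO : open Omega) (cO : convex_set Omega).
Hypotheses (bO : bounded_set Omega) (neO : Omega !=set0).
Implicit Types (x y g h : 'rV[R]_n) (t l r : R).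
Local Notation bdry := (topo_boundary Omega).
Local Notation d := (dist_boundary Omega).

Lemma convex_segment x y t : Omega x -> Omega y -> 0 <= t <= 1 ->
  Omega ((1 - t) *: x + t *: y).
Proof.
move=> Ox Oy /andP[t0 t1].
have := cO (Itv01 t0 t1) (mem_set Oy) (mem_set Ox).
by rewrite inE addrC.
Qed.

(** The point at the supremum of the parameters that stay in Omega is adherent to Omega. It cannot
    lie in the open set Omega, since a slightly larger parameter would then also be admissible. *)
Lemma segment_meets_boundary x y : Omega x -> ~ Omega y ->
  exists2 t, 0 <= t <= 1 & bdry (x + t *: (y - x)).
Proof.
move=> Ox Oy.
pose E := [set t | 0 <= t <= 1 /\ Omega (x + t *: (y - x))].
have E0 : E 0 by split; rewrite ?lexx ?ler01// scale0r addr0.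
have ubE : ubound E 1 by move=> t [/andP[]].
have hE : has_sup E by split; [exists 0|exists 1].
have s01 : 0 <= sup E <= 1.
  apply/andP; split; first exact: ub_le_sup (hE.2) _ E0.
  by apply: ge_sup => //; exists 0.
exists (sup E) => //; split.
  move=> B /nbhs_ballP[e /= e0 eB].
  have yx0 : 0 < `|y - x| + 1 by rewrite ltr_wpDl.
  have [t [t01 Ot] te] := sup_adherent (divr_gt0 e0 yx0) hE.
  exists (x + t *: (y - x)); split => //; apply: eB.
  rewrite mx_norm_ball /ball_/= opprD addrACA subrr add0r -scalerBl normrZ.
  have tE : t <= sup E by apply: ub_le_sup hE.2 _ _.
  rewrite ger0_norm ?subr_ge0//.
  apply: (@le_lt_trans _ _ ((sup E - t) * (`|y - x| + 1))).
    by rewrite ler_wpM2l ?subr_ge0// lerDl.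
  by rewrite -ltr_pdivlMr//; lra.
rewrite (interior_id _).1// => Oz.
have [e e0 eO] := open_enorm oO Oz.
have s1 : sup E < 1.
  rewrite lt_neqAle (andP s01).2 andbT; apply/eqP => s1; apply: Oy.
  by move: Oz; rewrite s1 scale1r addrC subrK.
have yx0 : 0 < enorm (y - x) + 1 by rewrite ltr_wpDl// enorm_ge0.
(* The first bound keeps the parameter at most 1, the second keeps the point in the ball of radius
   e; adding 1 to the length avoids a division by zero. *)
pose r := Num.min (1 - sup E) (e / (2 * (enorm (y - x) + 1))).
have r0 : 0 < r by rewrite lt_min subr_gt0 s1 divr_gt0// mulr_gt0.
have : E (sup E + r).
  split.
    rewrite addr_ge0 ?(andP s01).1 ?(ltW r0)//= -lerBrDl.
    by rewrite ge_min lexx.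
  apply: eO; rewrite opprD addrACA subrr add0r -scalerBl enormZ.
  rewrite opprD addrA subrr add0r normrN gtr0_norm//.
  apply: (@lt_trans _ _ (r * (enorm (y - x) + 1))); first by rewrite ltr_pM2l// ltrDl.
  apply: (@le_lt_trans _ _ (e / 2)); last by lra.
  rewrite -ler_pdivlMr// -mulrA -invfM.
  by rewrite ge_min lexx orbT.
move=> /(ub_le_sup hE.2); lra.
Qed.

Lemma boundary_notin h : bdry h -> ~ Omega h.
Proof. by move=> [_ +]; rewrite (interior_id _).1. Qed.

(** Over an empty boundary the infimum defining d would be a default value. A segment from Omega to
    a vector longer than the bound on Omega crosses the boundary. *)
Lemma boundary_nonempty : bdry !=set0.
Proof.
have [x Ox] := neO; have [M [_ /(_ (`|M| + 1))]] := bO.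
rewrite ltr_pwDr ?ler_norm// => /(_ isT) HM.
pose y : 'rV[R]_n := const_mx (`|M| + 2).
have Oy : ~ Omega y.
  move=> /HM /=; have := coord_le_norm y (Ordinal n0); rewrite mxE.
  have := ler_norm (`|M| + 2); lra.
by have [t _ bt] := segment_meets_boundary Ox Oy; eexists; exact: bt.
Qed.

Lemma dist_boundary_le g h : bdry h -> d g <= enorm (g - h).
Proof.
move=> bh; apply: ge_inf; last by exists h.
by exists 0 => _ [k _ <-]; exact: enorm_ge0.
Qed.

Lemma dist_boundary_ge g r : (forall h, bdry h -> r <= enorm (g - h)) -> r <= d g.
Proof.
move=> H; apply: lb_le_inf => [|_ [h bh <-]]; last exact: H.
by have [h bh] := boundary_nonempty; exists (enorm (g - h)), h.
Qed.

Lemma dist_boundary_ge0 g : 0 <= d g.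
Proof. by apply: dist_boundary_ge => h _; exact: enorm_ge0. Qed.

(** Otherwise the segment from g to y would meet the boundary at distance at most |y - g|, which is
    less than d(g). *)
Lemma ball_dist_boundary g y : Omega g -> enorm (y - g) < d g -> Omega y.
Proof.
move=> Og yg; apply: contrapT => Oy.
have [t /andP[t0 t1] bt] := segment_meets_boundary Og Oy.
have := dist_boundary_le g bt.
rewrite opprD addrA subrr add0r enormN enormZ ger0_norm// => dt.
have := ler_wpM2r (enorm_ge0 (y - g)) t1; rewrite mul1r => ?; lra.
Qed.

Lemma dist_boundary_gt0 g : Omega g -> 0 < d g.
Proof.
move=> Og; have [e e0 eO] := open_enorm oO Og.
apply: lt_le_trans e0 _; apply: dist_boundary_ge => h bh.
by rewrite leNgt; apply/negP => /eO; exact: boundary_notin.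
Qed.

(** The balls of radius d(g) and d(h) lie in Omega, and by convexity so does the ball whose centre
    and radius are the corresponding combinations. A boundary point k that is too close is written
    with a single vector z of norm less than 1, scaled by d(g) at g and by d(h) at h. *)
Lemma dist_boundary_concave g h l : Omega g -> Omega h -> 0 <= l <= 1 ->
  (1 - l) * d g + l * d h <= d ((1 - l) *: g + l *: h).
Proof.
move=> Og Oh l01; apply: dist_boundary_ge => k bk; rewrite leNgt; apply/negP => kr.
apply: (boundary_notin bk).
set gl := (1 - l) *: g + l *: h in kr *; set r := (1 - l) * d g + l * d h in kr.
have r0 : 0 < r by apply: le_lt_trans kr; exact: enorm_ge0.
pose z := r^-1 *: (k - gl).
have z1 : enorm z < 1.
  rewrite enormZ gtr0_norm ?invr_gt0// enormB mulrC ltr_pdivrMr//.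
  by rewrite mul1r.
have -> : k = (1 - l) *: (g + d g *: z) + l *: (h + d h *: z).
  apply/rowP => i; rewrite !mxE.
  have : r * z 0 i = k 0 i - gl 0 i by rewrite !mxE mulVKf// gt_eqF.
  by rewrite /gl /r !mxE; move: (z 0 i) => zi; lra.
have in_ball x : Omega x -> Omega (x + d x *: z).
  move=> Ox; apply: (ball_dist_boundary Ox).
  rewrite addrAC subrr add0r enormZ gtr0_norm ?dist_boundary_gt0//.
  by rewrite gtr_pMr// dist_boundary_gt0.
by apply: convex_segment => //; exact: in_ball.
Qed.

Lemma dist_boundary_lipschitz g h : `|d g - d h| <= enorm (g - h).
Proof.
have H x y : d x - d y <= enorm (x - y).
  rewrite lerBlDr addrC -lerBlDr; apply: dist_boundary_ge => k bk.
  rewrite lerBlDr; apply: le_trans (dist_boundary_le x bk) _.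
  rewrite (_ : x - k = (y - k) + (x - y)); last first.
    by apply/rowP => i; rewrite !mxE; ring.
  exact: ler_enormD.
by rewrite ler_norml H andbT lerNl opprB enormB H.
Qed.

Lemma dist_boundary_continuous : continuous d.
Proof.
apply: (@lipschitz_continuous_rV _ _ _ 1) => x y.
by rewrite mul1r dist_boundary_lipschitz.
Qed.

(** [dist_boundary] is positive also at points outside the closure of Omega. Extension by zero gives
    a function whose positivity certifies membership in Omega, so that its truncations serve as
    cutoffs. *)
Definition dist_inside g : R := if `[< Omega g >] then d g else 0.

Lemma dist_insideE g : Omega g -> dist_inside g = d g.
Proof. by move=> /asboolT Og; rewrite /dist_inside Og. Qed.

Lemma dist_inside_out g : ~ Omega g -> dist_inside g = 0.
Proof. by move=> /asboolF Og; rewrite /dist_inside Og. Qed.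

Lemma dist_inside_ge0 g : 0 <= dist_inside g.
Proof. by rewrite /dist_inside; case: ifP => // _; exact: dist_boundary_ge0. Qed.

Lemma dist_inside_gt0 g : 0 < dist_inside g -> Omega g.
Proof.
by move=> g0; apply: contrapT => /dist_inside_out g1; rewrite g1 ltxx in g0.
Qed.

(** The extension creates no jump: for x inside and y outside, [ball_dist_boundary] gives d(x) <= |x
    - y|. *)
Lemma dist_inside_lipschitz g h :
  `|dist_inside g - dist_inside h| <= enorm (g - h).
Proof.
have H x y : Omega x -> ~ Omega y -> d x <= enorm (x - y).
  move=> Ox Oy; rewrite leNgt; apply/negP; rewrite enormB.
  by move=> /(ball_dist_boundary Ox).
have [Og|Og] := pselect (Omega g); have [Oh|Oh] := pselect (Omega h).
- by rewrite !dist_insideE// dist_boundary_lipschitz.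
- by rewrite dist_insideE// dist_inside_out// subr0 ger0_norm ?dist_boundary_ge0// H.
- rewrite (dist_inside_out Og) dist_insideE// sub0r normrN enormB.
  by rewrite ger0_norm ?dist_boundary_ge0// H.
- by rewrite !dist_inside_out// subrr normr0 enorm_ge0.
Qed.

Lemma dist_inside_bounded : exists M, forall g, dist_inside g <= M.
Proof.
have [k bk] := boundary_nonempty; have [M [_ /(_ (`|M| + 1))]] := bO.
rewrite ltr_pwDr ?ler_norm// => /(_ isT) HM.
exists (n%:R * (`|M| + 1) + enorm k) => g.
have [Og|Og] := pselect (Omega g); last first.
  by rewrite dist_inside_out// addr_ge0 ?enorm_ge0// mulr_ge0// addr_ge0.
rewrite dist_insideE//; apply: le_trans (dist_boundary_le g bk) _.
apply: le_trans (ler_enormD _ _) _; rewrite enormN lerD2r.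
apply: le_trans (enorm_le_norm _) _; rewrite ler_wpM2l//.
exact: HM.
Qed.

Lemma domain_bounded_coord : exists M, 0 < M /\ forall g i, Omega g -> `|g 0 i| <= M.
Proof.
have [M [_ /(_ (`|M| + 1))]] := bO.
rewrite ltr_pwDr ?ler_norm// => /(_ isT) HM.
exists (`|M| + 1); split; first by rewrite ltr_wpDl.
by move=> g i Og; apply: le_trans (coord_le_norm _ _) _; exact: HM.
Qed.

Lemma lebesgue_rV_domain_lty : (lebesgue_rV R n Omega < +oo)%E.
Proof.
have [M [M0 HM]] := domain_bounded_coord.
pose A (i : 'I_n) : set R := `[- M, M]%classic.
have mA i : measurable (A i) by exact: measurable_itv.
apply: (@le_lt_trans _ _ (lebesgue_rV R n [set x | forall i, A i (x 0 i)])).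
  apply: le_measure; rewrite ?inE.
  - exact: open_measurable_rV.
  - exact: measurable_box mA.
  - by move=> g Og i /=; rewrite /A/= in_itv/= -ler_norml HM.
rewrite (lebesgue_rV_box mA).
rewrite (eq_bigr (fun=> (2 * M)%:E)) ?prodEFin ?ltry// => i _.
rewrite lebesgue_measure_itv/= lte_fin gtrN// -EFinB; congr EFin; lra.
Qed.

End dist_boundary.

Arguments dist_inside {R n} Omega g.

Definition concave_on (R : realType) (n : nat) (Omega : set 'rV[R]_n)
    (f : 'rV[R]_n -> R) := forall g h l, Omega g -> Omega h -> 0 <= l <= 1 ->
  (1 - l) * f g + l * f h <= f ((1 - l) *: g + l *: h).

Definition nonexpansive (R : realType) (n : nat) (f : 'rV[R]_n -> R) :=
  forall g h, `|f g - f h| <= enorm (g - h).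

(** * One-sided directional derivatives of concave functions *)

Section right_derivative.
Context {R : realType} {n : nat} {Omega : set 'rV[R]_n} {f : 'rV[R]_n -> R}.
Hypotheses (oO : open Omega) (cf : concave_on Omega f) (lf : nonexpansive f).
Implicit Types (g h Z W : 'rV[R]_n) (s t : R).

Definition slope g Z t := (f (g + t *: Z) - f g) / t.

(** A right limit, because concavity makes it exist everywhere in Omega, while the two-sided
    derivative may fail to exist. The left derivative along Z is minus the value at -Z. *)
Definition rderive g Z : R := lim (slope g Z t @[t --> 0^'+]).

Lemma segment_in_open g Z : Omega g ->
  exists2 tau, 0 < tau & forall t, `|t| <= tau -> Omega (g + t *: Z).
Proof.
move=> Og; have [e e0 eO] := open_enorm oO Og.
have Z0 : 0 < enorm Z + 1 by rewrite ltr_wpDl// enorm_ge0.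
exists (e / (2 * (enorm Z + 1))) => [|t tu]; first by rewrite divr_gt0// mulr_gt0.
apply: eO; rewrite opprD addrA subrr add0r enormN enormZ.
apply: (@le_lt_trans _ _ (`|t| * (enorm Z + 1))); first by rewrite ler_wpM2l// lerDl.
apply: (@le_lt_trans _ _ (e / 2)); last by lra.
by rewrite -ler_pdivlMr// -mulrA -invfM.
Qed.

Lemma slope_le g Z s t : Omega g -> Omega (g + t *: Z) -> 0 < s <= t ->
  slope g Z t <= slope g Z s.
Proof.
move=> Og Ot /andP[s0 st]; have t0 : 0 < t by apply: lt_le_trans st.
have st01 : 0 <= s / t <= 1.
  by rewrite divr_ge0 ?(ltW s0) ?(ltW t0)//= ler_pdivrMr// mul1r.
have := @cf g (g + t *: Z) (s / t) Og Ot st01.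
rewrite (_ : _ *: g + _ = g + s *: Z); last first.
  by apply/rowP => i; rewrite !mxE; field; exact: lt0r_neq0.
rewrite /slope => H; rewrite ler_pdivrMr// mulrAC ler_pdivlMr//.
have [k ks] : exists k, s = k * t by exists (s / t); rewrite divfK// gt_eqF.
move: H; rewrite ks mulfK ?gt_eqF// mulrA ler_pM2r// => H.
lra.
Qed.

Lemma slope_le_enorm g Z t : 0 < t -> `|slope g Z t| <= enorm Z.
Proof.
move=> t0; rewrite normrM normfV (gtr0_norm t0) ler_pdivrMr//.
apply: le_trans (lf _ _) _; rewrite addrAC subrr add0r enormZ gtr0_norm//.
by rewrite mulrC.
Qed.

(** By concavity the slopes increase as t decreases to 0, and the Lipschitz bound keeps them below
    |Z|. *)
Lemma slope_cvg g Z : Omega g -> slope g Z t @[t --> 0^'+] --> rderive g Z.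
Proof.
move=> Og; have [tau tau0 tO] := segment_in_open Z Og.
have : cvg (slope g Z t @[t --> 0^'+]).
  apply: cvgP; apply: (@nonincreasing_at_right_cvgr _ _ 0 (BRight tau)).
  - by rewrite bnd_simp.
  - move=> s t; rewrite !in_itv/= => /andP[s0 st] /andP[t0 tt] le_st.
    by apply: slope_le => //; [apply: tO; rewrite gtr0_norm|rewrite s0].
  - exists (enorm Z) => y [t /=]; rewrite in_itv/= => /andP[t0 _] <-.
    by apply: le_trans (ler_norm _) _; exact: slope_le_enorm.
by [].
Qed.

Lemma slope_le_rderive g Z t : Omega g -> Omega (g + t *: Z) -> 0 < t ->
  slope g Z t <= rderive g Z.
Proof.
move=> Og Ot t0; apply: (cvgr_to_ge (slope_cvg Og)); near=> s.
apply: slope_le => //; apply/andP; split; near: s.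
  exact: nbhs_right_gt.
exact: nbhs_right_le.
Unshelve. all: by end_near. Qed.

Lemma rderive_le_enorm g Z : Omega g -> `|rderive g Z| <= enorm Z.
Proof.
move=> Og; apply: (cvgr_to_le (cvg_norm (slope_cvg Og))); near=> s.
by apply: slope_le_enorm; near: s; exact: nbhs_right_gt.
Unshelve. all: by end_near. Qed.

Lemma rderive_sequence g Z (u : R^nat) : Omega g -> (forall i, 0 < u i) ->
  u @ \oo --> 0 -> slope g Z (u i) @[i --> \oo] --> rderive g Z.
Proof.
move=> Og u0 ul; have /cvg_at_rightP := slope_cvg Og (Z := Z).
by apply; split.
Qed.

Lemma harmonic_gt0 i : 0 < @harmonic R i.
Proof. by rewrite invr_gt0. Qed.

Lemma rderiveZ g Z a : Omega g -> 0 < a -> rderive g (a *: Z) = a * rderive g Z.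
Proof.
move=> Og a0.
have h0 := @cvg_harmonic R.
have : (fun i => slope g (a *: Z) (harmonic i)) @ \oo --> rderive g (a *: Z).
  by apply: rderive_sequence => // i; exact: harmonic_gt0.
have -> : (fun i => slope g (a *: Z) (harmonic i)) =
    (fun i => a * slope g Z (a * harmonic i)).
  apply/funext => i; rewrite /slope scalerA (mulrC _ a).
  by field; rewrite !lt0r_neq0// harmonic_gt0.
move=> c1; apply: (cvg_unique _ c1) => //.
apply: cvgMr; apply: rderive_sequence => // [i|].
  by rewrite mulr_gt0// harmonic_gt0.
by rewrite -(mulr0 a); exact: cvgMr.
Qed.

Lemma rderive0 g : rderive g 0 = 0.
Proof.
rewrite /rderive; under eq_fun do rewrite /slope scaler0 addr0 subrr mul0r.
exact: lim_cst.
Qed.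

(** The point g + t(Z + W) is the midpoint of g + 2tZ and g + 2tW, which is why the slopes along Z
    and W are taken with step 2t and the slope along Z + W with step t. *)
Lemma rderiveD g Z W : Omega g ->
  rderive g Z + rderive g W <= rderive g (Z + W).
Proof.
move=> Og; have h0 := @cvg_harmonic R.
have h20 : (fun i => 2 * @harmonic R i) @ \oo --> 0.
  by rewrite -(mulr0 2); exact: cvgMr.
have h2p i : 0 < 2 * @harmonic R i by rewrite mulr_gt0// harmonic_gt0.
have hp := harmonic_gt0.
have cZ := rderive_sequence (Z := Z) Og h2p h20.
have cW := rderive_sequence (Z := W) Og h2p h20.
have cZW := rderive_sequence (Z := Z + W) Og hp h0.
apply: (ler_cvg_to (cvgD cZ cW) cZW).
have [tau tau0 tO] := segment_in_open Z Og.
have [tau' tau0' tO'] := segment_in_open W Og.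
near=> i; rewrite -[leLHS]/(slope g Z (2 * harmonic i) + slope g W (2 * harmonic i)).
have tt : 2 * harmonic i <= tau by near: i; exact: (cvgr_le _ h20).
have tt' : 2 * harmonic i <= tau' by near: i; exact: (cvgr_le _ h20).
move: (harmonic i) (hp i) tt tt' => t t0 tt tt'.
have Oz : Omega (g + (2 * t) *: Z) by apply: tO; rewrite gtr0_norm// mulr_gt0.
have Ow : Omega (g + (2 * t) *: W) by apply: tO'; rewrite gtr0_norm// mulr_gt0.
have := @cf _ _ (2^-1) Oz Ow; rewrite invr_ge0 invf_le1// ler1n ler0n => /(_ isT).
rewrite (_ : _ *: _ + _ = g + t *: (Z + W)); last first.
  by apply/rowP => j; rewrite !mxE; field.
move=> H; rewrite /slope -mulrDl ler_pdivrMr ?mulr_gt0//.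
rewrite mulrCA divfK ?gt_eqF//; lra.
Unshelve. all: by end_near. Qed.

Lemma rderive_le_left g Z : Omega g -> rderive g Z <= - rderive g (- Z).
Proof.
by move=> Og; have := rderiveD Z (- Z) Og; rewrite subrr rderive0; lra.
Qed.

(** The chord slope between the two points separates them: it is at least the left derivative at the
    far end and at most the right derivative at g. *)
Lemma left_le_rderive g Z t : Omega g -> Omega (g + t *: Z) -> 0 < t ->
  - rderive (g + t *: Z) (- Z) <= rderive g Z.
Proof.
move=> Og Ot t0; apply: le_trans (slope_le_rderive Og Ot t0).
rewrite lerNl; apply: le_trans (slope_le_rderive Ot _ t0); last first.
  by rewrite scalerN addrK.
by rewrite /slope scalerN addrK -mulNr opprB.
Qed.

Lemma rderive_nonincreasing g Z t : Omega g -> Omega (g + t *: Z) -> 0 < t ->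
  rderive (g + t *: Z) Z <= rderive g Z.
Proof.
by move=> Og Ot t0; apply: le_trans (left_le_rderive Og Ot t0); exact: rderive_le_left.
Qed.

(* A superlinear functional that is odd along each axis is linear. *)
Lemma rderive_linear g Z : Omega g ->
  (forall i, rderive g (delta_mx 0 i) = - rderive g (- delta_mx 0 i)) ->
  rderive g Z = \sum_i Z 0 i * rderive g (delta_mx 0 i).
Proof.
move=> Og odd.
have lin1 c i : rderive g (c *: delta_mx 0 i) = c * rderive g (delta_mx 0 i).
  have [c0|c0|->] := ltgtP c 0.
  - rewrite -[c]opprK scaleNr -scalerN rderiveZ ?oppr_gt0//.
    by rewrite odd mulrN !mulNr opprK.
  - exact: rderiveZ.
  - by rewrite scale0r rderive0 mul0r.
have ge (V : 'rV[R]_n) : \sum_i V 0 i * rderive g (delta_mx 0 i) <= rderive g V.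
  rewrite [in leRHS](row_sum_delta V); elim/big_ind2 : _ => [|a b c d ab cd|i _].
  - by rewrite rderive0.
  - by apply: le_trans (rderiveD _ _ Og); exact: lerD.
  - by rewrite lin1.
apply/eqP; rewrite eq_le ge andbT; apply: le_trans (rderive_le_left _ Og) _.
rewrite lerNl -sumrN; apply: le_trans (ge (- Z)); rewrite le_eqVlt; apply/orP; left.
by apply/eqP/eq_bigr => i _; rewrite mxE mulNr.
Qed.

(** The quotient defining [partial] tends to the right derivative from one side and to the left
    derivative from the other. If these differ the limit does not exist and [lim] returns its
    default 0. Hence [partial] is measurable and bounded also at points where d is not
    differentiable. *)
Lemma partial_rderive g i : Omega g ->
  partial i f g = if rderive g (delta_mx 0 i) == - rderive g (- delta_mx 0 i)
    then rderive g (delta_mx 0 i) else 0.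
Proof.
move=> Og; set e := delta_mx 0 i.
pose q (h : R) := h^-1 * (f (h *: e + g) - f g).
have -> : partial i f g = lim (q @ 0^') by [].
have qr : q @ 0^'+ --> rderive g e.
  have -> : q = slope g e by apply/funext => h; rewrite /q /slope mulrC (addrC g).
  exact: slope_cvg.
have ql : q @ 0^'- --> - rderive g (- e).
  apply/cvg_at_leftNP; rewrite oppr0.
  have -> : q \o -%R = (fun t => - slope g (- e) t).
    apply/funext => h; rewrite /q /slope /= scalerN scaleNr (addrC g) invrN mulNr.
    by rewrite mulrC.
  by apply: cvgN; exact: slope_cvg.
case: ifPn => [/eqP eq|neq].
  by apply/cvg_lim => //; apply: (@cvg_at_right_left_dnbhs _ R^o) => //; rewrite eq.
apply: dvgP => /cvg_ex[l ql'].
have H1 : q @ 0^'+ --> l by apply: cvg_trans ql'; apply: cvg_app => A;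
  apply: (@filterS _ (nbhs (0 : R))) => t At t0; apply: At; rewrite gt_eqF.
have H2 : q @ 0^'- --> l by apply: cvg_trans ql'; apply: cvg_app => A;
  apply: (@filterS _ (nbhs (0 : R))) => t At t0; apply: At; rewrite lt_eqF.
move/eqP : neq; apply.
by rewrite (cvg_unique _ qr H1)// (cvg_unique _ ql H2).
Qed.

(** The direction depends on the point because a left-invariant field does. Along the fixed steps
    1/(i+1) the derivative is a pointwise limit of measurable slopes. *)
Lemma measurable_rderive (Z : 'rV[R]_n -> 'rV[R]_n) : measurable_fun setT Z ->
  measurable_fun Omega (fun g => rderive g (Z g)).
Proof.
move=> mZ.
have mf : measurable_fun setT f.
  apply: continuous_measurable_rV; first exact: openT.
  move=> x _; apply: (@lipschitz_continuous_rV _ _ _ 1) => y z.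
  by rewrite mul1r lf.
apply: (@measurable_fun_cvg _ _ _ _ (fun i g => slope g (Z g) (harmonic i))).
  move=> i; apply: measurable_funTS; apply: measurable_funM => //.
  apply: measurable_funB => //; apply: measurableT_comp => //.
  apply: measurable_fun_mx => a b; rewrite (ord1 a).
  under [X in measurable_fun _ X]funext do rewrite !mxE.
  apply: measurable_funD; first exact: measurable_mx_coord.
  apply: measurable_funM => //.
  exact: (measurableT_comp (measurable_mx_coord 0 b) mZ).
move=> g Og; apply: rderive_sequence => //; last exact: cvg_harmonic.
exact: harmonic_gt0.
Qed.

Lemma measurable_partial_concave i : measurable_fun Omega (partial i f).
Proof.
have mO : measurable Omega by exact: open_measurable_rV.
pose e : 'rV[R]_n := delta_mx 0 i.
have m1 := @measurable_rderive (fun=> e) (measurable_cst _).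
have m2 := @measurable_rderive (fun=> - e) (measurable_cst _).
apply: (@eq_measurable_fun _ _ _ _ Omega (fun g => if rderive g e == - rderive g (- e)
    then rderive g e else 0)).
  by move=> g; rewrite inE => Og; rewrite partial_rderive.
apply: measurable_fun_if => //.
- by apply: measurable_fun_eqr => //; exact: measurableT_comp.
- exact: measurable_funS m1.
Qed.

End right_derivative.

Arguments slope {R n} f g Z t.
Arguments rderive {R n} f g Z.

(** * Testing along measure-preserving flows *)

Section transport.
Context {R : realType} {n : nat} {D : set 'rV[R]_n}.
Hypotheses (mD : measurable D) (fD : (lebesgue_rV R n D < +oo)%E).
Local Notation mu := (lebesgue_rV R n).

Lemma integrable_bounded_support (f : 'rV[R]_n -> R) (M : R) :
  measurable_fun setT f -> (forall x, `|f x| <= M) ->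
  (forall x, ~ D x -> f x = 0) -> mu.-integrable setT (EFin \o f).
Proof.
move=> mf fM f0.
have -> : EFin \o f = (EFin \o f) \_ D.
  apply/funext => x; rewrite patchE; case: ifPn => //.
  by rewrite notin_setE => /f0 /= ->.
apply: (iffLR (integrable_mkcond _ mD)); apply: measurable_bounded_integrable => //.
  exact: measurable_funTS.
exists M; split; first exact: num_real.
by move=> y My x _ /=; apply: le_trans (ltW My).
Qed.

Lemma integral_support (f : 'rV[R]_n -> R) : (forall x, ~ D x -> f x = 0) ->
  (\int[mu]_x (f x)%:E = \int[mu]_(x in D) (f x)%:E)%E.
Proof.
move=> f0; rewrite [RHS]integral_mkcond; apply: eq_integral => x _.
by rewrite patchE; case: ifPn => //; rewrite notin_setE => /f0 ->.
Qed.

Lemma integral_rV_preserving (T : 'rV[R]_n -> 'rV[R]_n) (f : 'rV[R]_n -> R) :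
  rV_preserving T -> measurable_fun setT f ->
  mu.-integrable setT (EFin \o (f \o T)) ->
  (\int[mu]_x (f (T x))%:E = \int[mu]_x (f x)%:E)%E.
Proof.
move=> [mT TE] mf intf.
have mEf : measurable_fun setT (EFin \o f) by exact/measurable_EFinP.
have := @integral_pushforward _ _ _ _ R T mT mu setT (EFin \o f) mEf.
rewrite preimage_setT => /(_ intf measurableT) /= <-.
by apply: eq_measure_integral => A mA _ /=; rewrite /pushforward TE.
Qed.

(** A discrete integration by parts: the change of variables by T turns the integral of b (phi o T)
    into that of (b o T') phi, and the common term b phi is subtracted from both. *)
Lemma integral_transport (T T' : 'rV[R]_n -> 'rV[R]_n) (b phi : 'rV[R]_n -> R)
    (B M : R) : rV_preserving T -> rV_preserving T' -> cancel T T' ->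
  measurable_fun setT b -> measurable_fun setT phi ->
  (forall x, `|b x| <= B) -> (forall x, `|phi x| <= M) ->
  (forall x, ~ D x -> b x = 0) -> (forall x, ~ D x -> phi x = 0) ->
  (\int[mu]_x (b x * (phi (T x) - phi x))%:E =
   \int[mu]_x (phi x * (b (T' x) - b x))%:E)%E.
Proof.
move=> pT pT' TK mb mphi bB phiM b0 phi0.
have mT := pT.1; have mT' := pT'.1.
have bnd (f g : 'rV[R]_n -> R) (K K' : R) : (forall x, `|f x| <= K) ->
    (forall x, `|g x| <= K') -> forall x, `|f x * g x| <= K * K'.
  by move=> fK gK x; rewrite normrM ler_pM.
have mbT : measurable_fun setT (b \o T') by exact: measurableT_comp.
have mphiT : measurable_fun setT (phi \o T) by exact: measurableT_comp.
have i1 : mu.-integrable setT (EFin \o (fun x => b x * phi (T x))).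
  apply: (@integrable_bounded_support _ (B * M)).
  - exact: measurable_funM.
  - by apply: bnd => // x; exact: phiM.
  - by move=> x /b0 ->; rewrite mul0r.
have i2 : mu.-integrable setT (EFin \o (fun x => b x * phi x)).
  apply: (@integrable_bounded_support _ (B * M)).
  - exact: measurable_funM.
  - exact: bnd.
  - by move=> x /b0 ->; rewrite mul0r.
have i3 : mu.-integrable setT (EFin \o (fun x => b (T' x) * phi x)).
  apply: (@integrable_bounded_support _ (B * M)).
  - exact: measurable_funM.
  - by apply: bnd => // x; exact: bB.
  - by move=> x /phi0 ->; rewrite mulr0.
transitivity (\int[mu]_x (b x * phi (T x))%:E - \int[mu]_x (b x * phi x)%:E)%E.
  rewrite -integralB_EFin//; apply: eq_integral => x _ /=.
  by rewrite -EFinB mulrBr.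
transitivity (\int[mu]_x (b (T' x) * phi x)%:E - \int[mu]_x (b x * phi x)%:E)%E.
  congr (_ - _)%E.
  rewrite -[RHS](@integral_rV_preserving T (fun x => b (T' x) * phi x)) //.
  - by apply: eq_integral => x _; rewrite TK.
  - exact: measurable_funM.
  - rewrite (_ : _ \o T = fun x => b x * phi (T x))//.
    by apply/funext => x /=; rewrite TK.
rewrite -integralB_EFin//; apply: eq_integral => x _ /=.
by rewrite -EFinB mulrBr (mulrC (phi x)) (mulrC (phi x)).
Qed.

(* Monotonicity of b along the flow T makes each difference quotient of phi
   tested against b nonnegative after transport. *)
Lemma integral_flow_derivative_ge0 (T T' : nat -> 'rV[R]_n -> 'rV[R]_n)
    (t : nat -> R) (b phi psi : 'rV[R]_n -> R) (B M L : R) :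
  (forall i, rV_preserving (T i)) -> (forall i, rV_preserving (T' i)) ->
  (forall i, cancel (T i) (T' i)) -> (forall i, 0 < t i) ->
  measurable_fun setT b -> measurable_fun setT phi ->
  (forall x, `|b x| <= B) -> (forall x, `|phi x| <= M) ->
  (forall x, ~ D x -> b x = 0) -> (forall x, ~ D x -> phi x = 0) ->
  (forall x, 0 <= phi x) ->
  (forall i x, phi x != 0 -> b x <= b (T' i x)) ->
  (forall i x, D x -> `|phi (T i x) - phi x| <= L * t i) ->
  (forall x, D x -> (phi (T i x) - phi x) / t i @[i --> \oo] --> psi x) ->
  (0 <= \int[mu]_(x in D) (b x * psi x)%:E)%E.
Proof.
move=> pT pT' TK t0 mb mphi bB phiM b0 phi0 phi_ge0 mono lip cpsi.
pose q i x := b x * ((phi (T i x) - phi x) / t i).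
have mq i : measurable_fun setT (q i).
  apply: measurable_funM => //; apply: measurable_funM => //.
  by apply: measurable_funB => //; exact: (measurableT_comp mphi (pT i).1).
have cq x : D x -> q i x @[i --> \oo] --> b x * psi x.
  by move=> Dx; apply: cvgMr; exact: cpsi.
have qL i x : D x -> `|q i x| <= B * L.
  move=> Dx; rewrite /q !normrM normfV (gtr0_norm (t0 i)).
  rewrite ler_pM ?divr_ge0//; first exact: ltW.
  by rewrite ler_pdivrMr// lip.
have mbpsi : measurable_fun D (fun x => b x * psi x).
  by apply: (@measurable_fun_cvg _ _ _ D q) => // i; exact: measurable_funTS.
have mqD i : measurable_fun D (EFin \o q i).
  by apply/measurable_EFinP; exact: measurable_funTS.
have iBL : mu.-integrable D (EFin \o cst (B * L)) by
  apply: measurable_bounded_integrable => //; exists `|B * L|; split;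
  [exact: num_real|move=> y ly x _ /=; exact: ltW].
have mEbpsi : measurable_fun D (EFin \o (fun x => b x * psi x)) by exact/measurable_EFinP.
have aeq : {ae mu, forall x, D x ->
    (EFin \o q i) x @[i --> \oo] --> (EFin \o (fun x => b x * psi x)) x}.
  by apply: aeW => x Dx; apply: cvg_EFin; [exact: nearW|exact: cq].
have aeL : {ae mu, forall x i, D x ->
    (`|(EFin \o q i) x| <= (EFin \o cst (B * L)%R) x)%E}.
  by apply: aeW => x i Dx; rewrite /= lee_fin qL.
have [_ _ cI] := dominated_convergence mD mqD mEbpsi aeq iBL aeL.
apply: (cvge_to_ge cI); apply: nearW => i.
rewrite -[leRHS]/(\int[mu]_(x in D) (q i x)%:E)%E.
rewrite -integral_support; last by move=> x /b0; rewrite /q => ->; rewrite mul0r.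
have -> : (\int[mu]_x (q i x)%:E = \int[mu]_x ((t i)^-1%:E * (b x * (phi (T i x) - phi x))%:E))%E.
  by apply: eq_integral => x _; rewrite -EFinM /q; congr EFin; ring.
have intb : mu.-integrable setT (EFin \o (fun x => b x * (phi (T i x) - phi x))).
  apply: (@integrable_bounded_support _ (B * (M + M))).
  - apply: measurable_funM => //; apply: measurable_funB => //.
    exact: (measurableT_comp mphi (pT i).1).
  - move=> x; rewrite normrM ler_pM//; apply: le_trans (ler_normB _ _) _.
    exact: lerD.
  - by move=> x /b0 ->; rewrite mul0r.
rewrite (integralZl measurableT intb).
apply: mule_ge0; first by rewrite lee_fin invr_ge0 ltW.
rewrite (integral_transport (pT i) (pT' i) (TK i) mb mphi bB phiM b0 phi0).
apply: integral_ge0 => x _; rewrite lee_fin.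
have [->|phix] := eqVneq (phi x) 0; first by rewrite mul0r.
by rewrite mulr_ge0// subr_ge0 mono.
Qed.

Lemma integral_le_cst (f : 'rV[R]_n -> R) (M : R) : measurable_fun D f ->
  (forall x, D x -> f x <= M) -> (forall x, D x -> 0 <= f x) ->
  (\int[mu]_(x in D) (f x)%:E <= M%:E * mu D)%E.
Proof.
move=> mf fM f0; rewrite -integral_cst//; apply: ge0_le_integral => //.
- exact/measurable_EFinP.
Qed.

(* By transport, the integrals of phi b and phi (b o T') differ by O(t). *)
Lemma ae_no_jump (T T' : nat -> 'rV[R]_n -> 'rV[R]_n) (t : nat -> R)
    (b c phi : 'rV[R]_n -> R) (B M : R) :
  (forall i, rV_preserving (T i)) -> (forall i, rV_preserving (T' i)) ->
  (forall i, cancel (T i) (T' i)) -> t @ \oo --> 0 ->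
  measurable_fun setT b -> measurable_fun setT c -> measurable_fun setT phi ->
  (forall x, `|b x| <= B) -> (forall x, `|phi x| <= M) ->
  (forall x, ~ D x -> b x = 0) -> (forall x, ~ D x -> phi x = 0) ->
  (forall x, 0 <= phi x) -> (forall x, b x <= c x) ->
  (forall i x, phi x != 0 -> c x <= b (T' i x)) ->
  (forall i x, D x -> `|phi (T i x) - phi x| <= t i) ->
  {ae mu, forall x, phi x != 0 -> b x = c x}.
Proof.
move=> pT pT' TK t0 mb mc mphi bB phiM b0 phi0 phi_ge0 bc cT lip.
have mphibc : measurable_fun setT (fun x => phi x * (c x - b x)).
  by apply: measurable_funM => //; exact: measurable_funB.
have phibc0 x : 0 <= phi x * (c x - b x) by rewrite mulr_ge0// subr_ge0.
(* Where phi does not vanish, c is at most b o T', so the nonnegative integrand is dominated by a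
   transported difference. Transporting it back leaves b times an increment of phi, of size at most
   B t_i. *)
have bnd i : (\int[mu]_x (phi x * (c x - b x))%:E <= (B * t i)%:E * mu D)%E.
  apply: (@le_trans _ _ (\int[mu]_x (phi x * (b (T' i x) - b x))%:E)%E).
    apply: ge0_le_integral => //.
    - by move=> x _; rewrite lee_fin.
    - exact/measurable_EFinP.
    - apply/measurable_EFinP; apply: measurable_funM => //.
      by apply: measurable_funB => //; exact: (measurableT_comp mb (pT' i).1).
    - move=> x _; rewrite lee_fin; have [->|px] := eqVneq (phi x) 0; first by rewrite !mul0r.
      by rewrite ler_wpM2l// lerD2r cT.
  rewrite -(integral_transport (pT i) (pT' i) (TK i) mb mphi bB phiM b0 phi0).
  apply: (@le_trans _ _ (\int[mu]_x `|b x * (phi (T i x) - phi x)|%:E)%E).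
    apply: le_integral => //.
    - apply: (@integrable_bounded_support _ (B * (M + M))).
      + apply: measurable_funM => //; apply: measurable_funB => //.
        exact: (measurableT_comp mphi (pT i).1).
      + move=> x; rewrite normrM ler_pM//; apply: le_trans (ler_normB _ _) _.
        exact: lerD.
      + by move=> x /b0 ->; rewrite mul0r.
    - apply: (@integrable_bounded_support _ (B * (M + M))).
      + apply: measurableT_comp => //; apply: measurable_funM => //.
        apply: measurable_funB => //; exact: (measurableT_comp mphi (pT i).1).
      + move=> x; rewrite normr_id normrM ler_pM//; apply: le_trans (ler_normB _ _) _.
        exact: lerD.
      + by move=> x /b0 ->; rewrite mul0r normr0.
    - by move=> x _; rewrite lee_fin ler_norm.
  rewrite integral_support; last by move=> x /b0 ->; rewrite mul0r normr0.
  apply: integral_le_cst => [|x Dx|//].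
    apply: measurable_funTS; apply: measurableT_comp => //.
    apply: measurable_funM => //; apply: measurable_funB => //.
    exact: (measurableT_comp mphi (pT i).1).
  by rewrite normrM ler_pM// lip.
(* The integral does not depend on i, while its bound tends to 0; a nonnegative integrand with zero
   integral then vanishes almost everywhere. *)
have I0 : (\int[mu]_x (phi x * (c x - b x))%:E = 0)%E.
  apply/eqP; rewrite eq_le; apply/andP; split; last first.
    by apply: integral_ge0 => x _; rewrite lee_fin.
  have fin : mu D \is a fin_num by rewrite ge0_fin_numE.
  have cvg0 : (fun i => ((B * t i)%:E * mu D)%E) @ \oo --> 0%E.
    rewrite -(fineK fin); under eq_fun do rewrite -EFinM.
    apply: cvg_EFin; first exact: nearW.
    rewrite -[X in _ --> X](mul0r (fine (mu D))).
    by apply: cvgMl; rewrite -(mulr0 B); exact: cvgMr.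
  by apply: (cvge_to_ge cvg0); apply: nearW.
have mE : measurable_fun setT (fun x => (phi x * (c x - b x))%:E) by exact/measurable_EFinP.
have : (\int[mu]_x `|(phi x * (c x - b x))%:E| = 0)%E.
  by rewrite -[RHS]I0; apply: eq_integral => x _; rewrite gee0_abs// lee_fin.
move/(ae_eq_integral_abs mu measurableT mE); apply: filterS => x /(_ I) /= [/eqP].
rewrite mulf_eq0 => /orP[->//|]; rewrite subr_eq0 => /eqP -> //.
Qed.

End transport.

(** * Horizontal geometry *)

Section group_geometry.
Context {R : realType} {m k : nat} (G : stratified2 R m k).
Local Notation n := (m + k)%N.
Implicit Types (g h : 'rV[R]_n) (v w : 'rV[R]_m) (s t : R).

(** Polarisation: expand the bracket of x + y with itself. *)
Lemma structure_mx_skew i (j l : 'I_m) :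
  structure_mx G i j l = - structure_mx G i l j.
Proof.
rewrite !mxE; set x := delta_mx 0 _; set y := delta_mx 0 (lshift k j).
have D1 a b c : bracket G (a + b) c = bracket G a c + bracket G b c.
  by have := bracket_linearl G c 1 a b; rewrite !scale1r.
have D2 a b c : bracket G c (a + b) = bracket G c a + bracket G c b.
  by have := bracket_linearr G c 1 a b; rewrite !scale1r.
have := bracket_alt G (x + y); rewrite D1 !D2 !bracket_alt add0r addr0.
move=> /rowP/(_ (rshift m i)); rewrite !mxE => /eqP.
by rewrite addr_eq0 => /eqP.
Qed.

Lemma structure_act_dotpE i g v : dotp (structure_act G i g) v =
  \sum_j \sum_l lsubmx g 0 l * structure_mx G i j l * v 0 j.
Proof.
rewrite /dotp; apply: eq_bigr => j _; rewrite mxE mulr_suml.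
by apply: eq_bigr => l _; rewrite [_^T _ _]mxE.
Qed.

Lemma structure_act_self i g : dotp (structure_act G i g) (lsubmx g) = 0.
Proof.
rewrite structure_act_dotpE; set S := (X in X = 0).
suff SN : S = - S by lra.
rewrite {1}/S exchange_big -sumrN /=; apply: eq_bigr => j _.
rewrite -sumrN; apply: eq_bigr => l _; rewrite structure_mx_skew; ring.
Qed.

Lemma structure_actD i g h :
  structure_act G i (g + h) = structure_act G i g + structure_act G i h.
Proof. by rewrite /structure_act linearD mulmxDl. Qed.

Lemma structure_actZ i s g : structure_act G i (s *: g) = s *: structure_act G i g.
Proof. by rewrite /structure_act linearZ/= scalemxAl. Qed.

(* The left-invariant field v_1 X_1 + ... + v_m X_m. *)
Definition horizontal_field v g : 'rV[R]_n :=
  row_mx v (\row_i (2^-1 * dotp (structure_act G i g) v)).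

(** Written as an Euler step, this is the exact flow, because the field is constant along the line
    ([horizontal_field_flow]). *)
Definition horizontal_flow v t g := g + t *: horizontal_field v g.

Lemma horizontal_fieldZ s v g :
  horizontal_field (s *: v) g = s *: horizontal_field v g.
Proof.
rewrite /horizontal_field scale_row_mx; congr row_mx.
by apply/rowP => i; rewrite !mxE dotpZr mulrCA.
Qed.

(** After time t the V_2 components of the field have changed by t/2 <B^(i) v, v>, which is zero by
    skew-symmetry. *)
Lemma horizontal_field_flow v t g :
  horizontal_field v (horizontal_flow v t g) = horizontal_field v g.
Proof.
rewrite /horizontal_field; congr row_mx; apply/rowP => i; rewrite !mxE.
congr (_ * _); rewrite /horizontal_flow structure_actD structure_actZ dotpDl dotpZl.
rewrite -[X in dotp (structure_act G i (horizontal_field v g)) X](row_mxKl v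
  (\row_i (2^-1 * dotp (structure_act G i g) v))).
by rewrite structure_act_self mulr0 addr0.
Qed.

Lemma horizontal_flowK v t : cancel (horizontal_flow v t) (horizontal_flow v (- t)).
Proof.
move=> g; rewrite {1}/horizontal_flow horizontal_field_flow scaleNr.
by rewrite /horizontal_flow addrK.
Qed.

Lemma gmul_horizontal g v : gmul G g (row_mx v 0) = g + horizontal_field v g.
Proof.
rewrite /gmul /horizontal_field row_mxKl -addrA add_row_mx addr0 add0r.
by [].
Qed.

(** The product of g^-1 and g exp(v) is v, with no V_2 part, so the dilation acts on it as
    multiplication by l; the field is linear in v, which makes the group line a Euclidean
    segment. *)
Lemma gline_horizontal g v l :
  gline G g (gmul G g (row_mx v 0)) l =
  (1 - l) *: g + l *: gmul G g (row_mx v 0).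
Proof.
have inv : gmul G (ginv g) (gmul G g (row_mx v 0)) = row_mx v 0.
  rewrite gmul_horizontal /gmul /ginv addrA addNr add0r.
  rewrite /horizontal_field add_row_mx addr0; congr row_mx.
  apply/rowP => i; rewrite !mxE linearD/= row_mxKl.
  rewrite -scaleN1r structure_actZ dotpZl dotpDr structure_act_self add0r; ring.
rewrite /gline inv /dilation row_mxKl row_mxKr scaler0 !gmul_horizontal.
rewrite horizontal_fieldZ scalerDr addrA; congr (_ + _).
by rewrite scalerBl scale1r subrK.
Qed.

Lemma concave_weakly_Hconcave (Omega : set 'rV[R]_n) u :
  concave_on Omega u -> weakly_Hconcave G Omega u.
Proof.
move=> cu g h l Og [Oh [w w1 wh]] l01.
have wE : w = row_mx (lsubmx w) 0 by rewrite -[LHS]hsubmxK w1.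
by rewrite -wh wE gline_horizontal -wE wh; exact: cu.
Qed.

(** Translates horizontal derivatives into Euclidean ones: formally the derivative of u in the
    direction [horizontal_field v g]. It is an identity between partials, valid also where these are
    default values. *)
Lemma gradH_dotp u g v :
  dotp (gradH G u g) v = \sum_p horizontal_field v g 0 p * partial p u g.
Proof.
rewrite big_split_ord/= /dotp.
rewrite (eq_bigr (fun j => v 0 j * partial (lshift k j) u g +
    \sum_(i < k) 2^-1 * structure_act G i g 0 j * v 0 j * partial (rshift m i) u g)).
  rewrite big_split/=; congr (_ + _).
    by apply: eq_bigr => j _; rewrite /horizontal_field row_mxEl.
  rewrite exchange_big/=; apply: eq_bigr => i _.
  rewrite /horizontal_field row_mxEr mxE -mulrA /dotp !mulr_suml.
  by rewrite mulr_sumr; apply: eq_bigr => j _; ring.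
move=> j _; rewrite mxE /Xfield mulrDl mulrC; congr (_ + _).
by rewrite mulr_sumr mulr_suml; apply: eq_bigr => i _; ring.
Qed.

Lemma measurable_structure_act i j :
  measurable_fun setT (fun g => structure_act G i g 0 j).
Proof.
under [X in measurable_fun _ X]funext do rewrite mxE.
apply: measurable_sum => l; apply: measurable_funM => //.
under [X in measurable_fun _ X]funext do rewrite mxE.
exact: measurable_mx_coord.
Qed.

Lemma measurable_horizontal_field v : measurable_fun setT (horizontal_field v).
Proof.
apply: measurable_fun_mx => a p; rewrite (ord1 a) -(splitK p).
case: (fintype.split p) => j /=; rewrite /horizontal_field.
  under [X in measurable_fun _ X]funext do rewrite row_mxEl.
  exact: measurable_cst.
under [X in measurable_fun _ X]funext do rewrite row_mxEr mxE.
apply: measurable_funM => //; apply: measurable_sum => l; apply: measurable_funM => //.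
exact: measurable_structure_act.
Qed.

(** The flow is a shear of the V_2 coordinates, with increments that read only V_1, followed by the
    translation by t v in V_1. *)
Lemma rV_preserving_flow v t : rV_preserving (horizontal_flow v t).
Proof.
pose F g : 'rV[R]_n := row_mx 0 (\row_i (t * (2^-1 * dotp (structure_act G i g) v))).
have -> : horizontal_flow v t = (fun x => x + row_mx (t *: v) 0) \o (fun x => x + F x).
  apply/funext => g /=; rewrite /horizontal_flow -addrA; congr (_ + _).
  rewrite /F add_row_mx add0r addr0 scale_row_mx; congr row_mx.
  by apply/rowP => i; rewrite !mxE.
apply: rV_preserving_comp; first exact: rV_preserving_translate.
apply: (@rV_preserving_shear _ _ [set rshift m i | i in 'I_k]%SET) => [p|x p|x y xy].
- rewrite -(splitK p); case: (fintype.split p) => j /=; rewrite /F.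
    under [X in measurable_fun _ X]funext do rewrite row_mxEl mxE.
    exact: measurable_cst.
  under [X in measurable_fun _ X]funext do rewrite row_mxEr mxE.
  do 2 apply: measurable_funM => //.
  apply: measurable_sum => l; apply: measurable_funM => //.
  exact: measurable_structure_act.
- rewrite -(splitK p); case: (fintype.split p) => j /=; first by rewrite /F row_mxEl mxE.
  by rewrite imset_f.
- rewrite /F; congr row_mx; apply/rowP => i; rewrite !mxE; congr (_ * (_ * dotp _ _)).
  rewrite /structure_act; congr (_ *m _); apply/rowP => j; rewrite !mxE; apply: xy.
  by apply/imsetP => -[l _ /eqP]; rewrite eq_lrshift.
Qed.

Lemma horizontal_field_bounded (D : set 'rV[R]_n) v M :
  (forall g i, D g -> `|g 0 i| <= M) ->
  exists C, forall g, D g -> enorm (horizontal_field v g) <= C.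
Proof.
move=> DM.
have H (p : 'I_n) : exists C, forall g, D g -> `|horizontal_field v g 0 p| <= C.
  rewrite -(splitK p); case: (fintype.split p) => j /=; rewrite /horizontal_field.
    by exists `|v 0 j| => g Dg; rewrite row_mxEl.
  exists (\sum_l \sum_i M * `|structure_mx G j l i * v 0 l|) => g Dg.
  rewrite row_mxEr mxE structure_act_dotpE normrM.
  apply: (@le_trans _ _ (1 * `|\sum_l \sum_i lsubmx g 0 i * structure_mx G j l i * v 0 l|)).
    by rewrite ler_wpM2r// ger0_norm ?invr_ge0// invf_le1// ler1n.
  rewrite mul1r; apply: le_trans (ler_norm_sum _ _ _) _; apply: ler_sum => l _.
  apply: le_trans (ler_norm_sum _ _ _) _; apply: ler_sum => i _.
  by rewrite -mulrA normrM ler_wpM2r// mxE DM.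
have [C HC] := choice H.
exists (\sum_p C p) => g Dg; apply: le_trans (enorm_le_sum _) _.
by apply: ler_sum => p _; exact: HC.
Qed.

End group_geometry.

(** * The odd power of exponent p - 1 *)

Section signed_power.
Context {R : realType} (p : R).
Hypothesis p1 : 1 < p.
Implicit Types (s t c : R).

(** The derivative of |s|^p divided by p. The factor s gives the value 0 at s = 0, whatever the
    convention for the power of 0. *)
Definition dpow s : R := `|s| `^ (p - 2) * s.

Lemma dpow_ge0E s : 0 <= s -> dpow s = s `^ (p - 1).
Proof.
move=> s0; rewrite /dpow ger0_norm// mulrC.
rewrite (_ : p - 2 = p - 1 - 1); last by ring.
by rewrite mulr_powRB1// subr_gt0.
Qed.

Lemma dpowN s : dpow (- s) = - dpow s.
Proof. by rewrite /dpow normrN mulrN. Qed.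

Lemma dpow0 : dpow 0 = 0.
Proof. by rewrite /dpow mulr0. Qed.

Lemma dpow_mulr s : dpow s * s = `|s| `^ p.
Proof.
wlog s0 : s / 0 <= s => [H|].
  have [/H//|/ltW s0] := leP 0 s.
  by rewrite -[s]opprK dpowN mulrNN H ?oppr_ge0// !normrN.
rewrite dpow_ge0E// mulrC mulr_powRB1 ?ger0_norm//.
by apply: lt_trans p1.
Qed.

Lemma normr_dpow s : `|dpow s| = `|s| `^ (p - 1).
Proof.
rewrite /dpow normrM ger0_norm ?powR_ge0// -[RHS]dpow_ge0E// /dpow normr_id.
by [].
Qed.

Lemma dpow_nondecreasing s t : s <= t -> dpow s <= dpow t.
Proof.
have pp : 0 <= p - 1 by rewrite subr_ge0 ltW.
have H u v : 0 <= u -> u <= v -> dpow u <= dpow v.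
  move=> u0 uv; rewrite !dpow_ge0E//; last exact: le_trans uv.
  by apply: ge0_ler_powR => //; rewrite nnegrE//; exact: le_trans uv.
move=> st; have [s0|s0] := leP 0 s; first exact: H.
have [t0|t0] := leP 0 t.
  apply: (@le_trans _ _ 0).
    by rewrite -[s]opprK dpowN oppr_le0 dpow_ge0E ?powR_ge0// oppr_ge0 ltW.
  by rewrite dpow_ge0E ?powR_ge0.
by rewrite -[s]opprK -[t]opprK !(dpowN (- _)) lerN2 H ?lerN2// oppr_ge0 ltW.
Qed.

Lemma dpowM c s : 0 <= c -> dpow (c * s) = c `^ (p - 1) * dpow s.
Proof.
move=> c0; rewrite /dpow normrM powRM// ger0_norm// -[c `^ (p - 1)]dpow_ge0E//.
by rewrite /dpow (ger0_norm c0); ring.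
Qed.

Lemma dpow_bounded s K : `|s| <= K -> `|dpow s| <= K `^ (p - 1).
Proof.
move=> sK; rewrite normr_dpow; apply: ge0_ler_powR => //.
- by rewrite subr_ge0 ltW.
- by rewrite nnegrE; apply: le_trans sK.
Qed.

Lemma measurable_dpow : measurable_fun setT dpow.
Proof.
apply: measurable_funM => //.
exact: (measurableT_comp (measurable_powR (p - 2)) (@normr_measurable R setT)).
Qed.

End signed_power.

(** * Averaging over horizontal directions *)

Section ball_average.
Context {R : realType} {m : nat} (p : R).
Hypotheses (m0 : (0 < m)%N) (p1 : 1 < p).
Implicit Types (w x y xi eta : 'rV[R]_m).
Local Notation mu := (lebesgue_rV R m).

(** The ball is used instead of the sphere so that plain Lebesgue measure is the
    reflection-invariant measure. *)
Definition unit_ball : set 'rV[R]_m := [set x | dotp x x < 1].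
Local Notation B := unit_ball.

Lemma measurable_unit_ball : measurable B.
Proof.
rewrite (_ : B = setT `&` [set x | dotp x x < 1]); last by rewrite setTI.
have mq : measurable_fun setT (fun x : 'rV[R]_m => dotp x x).
  by apply: measurable_sum => i; apply: measurable_funM; exact: measurable_mx_coord.
have := mq measurableT _ (measurable_itv `]-oo, (1 : R)[); congr (measurable (_ `&` _)).
Qed.

Lemma unit_ball_coord x i : B x -> `|x 0 i| <= 1.
Proof.
move=> /ltW x1; apply: le_trans (coord_le_enorm _ _) _.
by rewrite -(@ler_pXn2r _ 2) ?nnegrE ?enorm_ge0// sqr_enorm expr1n.
Qed.

Lemma unit_ball_enorm x : B x -> enorm x <= 1.
Proof.
by move=> /ltW x1; rewrite -(@ler_pXn2r _ 2) ?nnegrE ?enorm_ge0// sqr_enorm expr1n.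
Qed.

Lemma lebesgue_rV_unit_ball_lty : (mu B < +oo)%E.
Proof.
pose A (i : 'I_m) : set R := `[- 1, 1]%classic.
have mA i : measurable (A i) by exact: measurable_itv.
apply: (@le_lt_trans _ _ (mu [set x | forall i, A i (x 0 i)])).
  apply: le_measure; rewrite ?inE.
  - exact: measurable_unit_ball.
  - exact: measurable_box mA.
  - by move=> g Og i /=; rewrite /A/= in_itv/= -ler_norml; exact: unit_ball_coord.
rewrite (lebesgue_rV_box mA).
rewrite (eq_bigr (fun=> 2%:E)) ?prodEFin ?ltry// => i _.
rewrite lebesgue_measure_itv/= lte_fin gtrN// -EFinB; congr EFin; lra.
Qed.

Definition ball_kernel xi eta (v : 'rV[R]_m) : R := dpow p (dotp xi v) * dotp eta v.

Lemma ball_kernel_bounded xi eta v : B v ->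
  `|ball_kernel xi eta v| <= enorm xi `^ (p - 1) * enorm eta.
Proof.
move=> Bv; have v1 := unit_ball_enorm Bv.
have H z : `|dotp z v| <= enorm z.
  apply: le_trans (dotp_le_enorm _ _) _.
  by rewrite -[leRHS]mulr1 ler_wpM2l// enorm_ge0.
by rewrite normrM ler_pM//; exact: dpow_bounded.
Qed.

Lemma measurable_ball_kernel xi eta : measurable_fun setT (ball_kernel xi eta).
Proof.
have md z : measurable_fun setT (fun v : 'rV[R]_m => dotp z v).
  by under eq_fun do rewrite dotpC; exact: measurable_dotp.
by apply: measurable_funM => //; exact: (measurableT_comp (measurable_dpow p)).
Qed.

Lemma integrable_ball_kernel xi eta :
  mu.-integrable B (EFin \o ball_kernel xi eta).
Proof.
apply: measurable_bounded_integrable.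
- exact: measurable_unit_ball.
- exact: lebesgue_rV_unit_ball_lty.
- by apply: measurable_funTS; exact: measurable_ball_kernel.
- exists (enorm xi `^ (p - 1) * enorm eta); split; first exact: num_real.
  move=> y ly v Bv /=; apply: le_trans (ltW ly); exact: ball_kernel_bounded.
Qed.

Definition ball_average xi eta : R := \int[mu]_(v in B) ball_kernel xi eta v.

Lemma ball_averageE xi eta :
  (\int[mu]_(v in B) (ball_kernel xi eta v)%:E = (ball_average xi eta)%:E)%E.
Proof.
rewrite /ball_average /Rintegral fineK//.
apply: integrable_fin_num; [exact: measurable_unit_ball|exact: integrable_ball_kernel].
Qed.

Lemma householder_adjoint w x y : dotp (householder w x) y = dotp x (householder w y).
Proof.
by rewrite /householder dotpDl dotpDr !dotpNl !dotpNr !dotpZl !dotpZr (dotpC w y); ring.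
Qed.

Lemma householderK w : dotp w w = 1 -> involutive (householder w).
Proof.
move=> w1 x; apply/rowP => i; rewrite /householder.
rewrite dotpDl dotpNl dotpZl w1 !mxE; ring.
Qed.

(** The reflection is self-adjoint, so it moves from xi and eta onto v, where it preserves both the
    ball and the measure. *)
Lemma ball_average_householder w xi eta : dotp w w = 1 ->
  ball_average (householder w xi) (householder w eta) = ball_average xi eta.
Proof.
move=> w1; have [mT TE] := rV_preserving_householder w1.
have kE v : ball_kernel (householder w xi) (householder w eta) v =
    ball_kernel xi eta (householder w v).
  by rewrite /ball_kernel !householder_adjoint.
have BE : householder w @^-1` B = B.
  apply/seteqP; split => v; rewrite /B /=.
    by rewrite householder_adjoint householderK.
  by rewrite householder_adjoint householderK.
apply: EFin_inj; rewrite -!ball_averageE.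
under eq_integral do rewrite kE.
have mk : measurable_fun setT (EFin \o ball_kernel xi eta).
  by apply/measurable_EFinP; exact: measurable_ball_kernel.
have ik : mu.-integrable (householder w @^-1` B) ((EFin \o ball_kernel xi eta) \o householder w).
  rewrite BE; apply: eq_integrable (integrable_ball_kernel (householder w xi) (householder w eta)).
    exact: measurable_unit_ball.
  by move=> v _; rewrite /= kE.
have := @integral_pushforward _ _ _ _ R (householder w) mT mu B _ mk ik measurable_unit_ball.
rewrite BE => <-.
by apply: eq_measure_integral => A mA _ /=; rewrite /pushforward TE.
Qed.

Lemma ball_averageDr xi eta eta' :
  ball_average xi (eta + eta') = ball_average xi eta + ball_average xi eta'.
Proof.
rewrite /ball_average -RintegralD; [|exact: measurable_unit_ball|exact: integrable_ball_kernel..].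
by apply: eq_Rintegral => v _; rewrite /ball_kernel dotpDl mulrDr.
Qed.

Lemma ball_averageZr c xi eta : ball_average xi (c *: eta) = c * ball_average xi eta.
Proof.
rewrite /ball_average -RintegralZl; [|exact: measurable_unit_ball|exact: integrable_ball_kernel..].
by apply: eq_Rintegral => v _; rewrite /ball_kernel dotpZl mulrCA.
Qed.

Lemma ball_averageZl c xi eta : 0 <= c ->
  ball_average (c *: xi) eta = c `^ (p - 1) * ball_average xi eta.
Proof.
move=> c0.
rewrite /ball_average -RintegralZl; [|exact: measurable_unit_ball|exact: integrable_ball_kernel..].
by apply: eq_Rintegral => v _; rewrite /ball_kernel dotpZl dpowM// mulrA.
Qed.

(** The reflection along eta fixes xi and negates eta, so the average equals its own opposite. *)
Lemma ball_average_ortho xi eta : dotp xi eta = 0 -> ball_average xi eta = 0.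
Proof.
move=> o; have [->|eta0] := eqVneq eta 0.
  by rewrite -(scale0r (0 : 'rV[R]_m)) ball_averageZr mul0r.
have e0 : enorm eta != 0 by apply: contra eta0 => /eqP/enorm_eq0 ->.
pose w := (enorm eta)^-1 *: eta.
have w1 : dotp w w = 1.
  by rewrite /w dotpZl dotpZr -sqr_enorm; field.
have := ball_average_householder xi eta w1.
have -> : householder w xi = xi.
  by rewrite /householder /w dotpZr o !mulr0 scale0r subr0.
have -> : householder w eta = (-1) *: eta.
  rewrite /householder /w dotpZr -sqr_enorm scalerA.
  have -> : 2 * ((enorm eta)^-1 * enorm eta ^+ 2) / enorm eta = 2 by field.
  by apply/rowP => i; rewrite !mxE; ring.
rewrite ball_averageZr; lra.
Qed.

Let e1 : 'rV[R]_m := delta_mx 0 (Ordinal m0).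

(** The reflection along xi - e1 carries the unit vector xi to e1. *)
Lemma ball_average_unit xi : dotp xi xi = 1 ->
  ball_average xi xi = ball_average e1 e1.
Proof.
move=> xi1; have e11 : dotp e1 e1 = 1 by rewrite dotp_delta mxE !eqxx.
have [->//|xe] := eqVneq xi e1.
pose z := xi - e1; have z0 : enorm z != 0.
  apply: contra xe => /eqP/enorm_eq0 z0; rewrite -subr_eq0; exact/eqP.
pose w := (enorm z)^-1 *: z.
have w1 : dotp w w = 1 by rewrite /w dotpZl dotpZr -sqr_enorm; field.
rewrite -(ball_average_householder xi xi w1).
suff -> : householder w xi = e1 by [].
have zz : enorm z ^+ 2 = 2 * dotp xi z.
  by rewrite sqr_enorm /z !dotpDl !dotpDr !dotpNl !dotpNr xi1 e11 (dotpC e1); ring.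
rewrite /householder /w dotpZr scalerA.
have -> : 2 * ((enorm z)^-1 * dotp xi z) / enorm z = 1.
  by rewrite mulrCA -zz; field.
by rewrite scale1r /z opprB addrC subrK.
Qed.

(* By invariance under reflections the average of dpow <xi, v> <eta, v> over the
   ball can only depend on <xi, eta> and |xi|. *)
Lemma ball_averageP xi eta : ball_average xi eta =
  ball_average e1 e1 * (enorm xi `^ (p - 2) * dotp xi eta).
Proof.
have [->|xi0] := eqVneq xi 0.
  rewrite dotp0l !mulr0 -(scale0r (0 : 'rV[R]_m)) ball_averageZl//.
  by rewrite powR0 ?mul0r// subr_eq0 gt_eqF.
have e0 : enorm xi != 0 by apply: contra xi0 => /eqP/enorm_eq0 ->.
have ege : 0 <= enorm xi := enorm_ge0 xi.
pose u := (enorm xi)^-1 *: xi.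
have u1 : dotp u u = 1 by rewrite /u dotpZl dotpZr -sqr_enorm; field.
have xiE : xi = enorm xi *: u by rewrite /u scalerA mulfV// scale1r.
rewrite [in LHS]xiE ball_averageZl//.
(* By linearity in eta only the component along xi contributes; the orthogonal one averages to 0. *)
have etaE : eta = dotp eta u *: u + (eta - dotp eta u *: u) by rewrite addrC subrK.
rewrite [in LHS]etaE ball_averageDr ball_averageZr ball_average_unit//.
rewrite (@ball_average_ortho u); last first.
  by rewrite dotpDr dotpNr dotpZr u1 (dotpC u); ring.
rewrite -(dpow_ge0E p1 ege) /dpow ger0_norm// /u dotpZr (dotpC eta).
by field.
Qed.

Lemma ball_average_gt0 : 0 < ball_average e1 e1.
Proof.
have e1v v : dotp e1 v = v 0 (Ordinal m0) by rewrite dotpC dotp_delta.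
have kE v : ball_kernel e1 e1 v = `|v 0 (Ordinal m0)| `^ p.
  by rewrite /ball_kernel e1v dpow_mulr.
(* With s = 1/(m+1) one has m s^2 < 1, so the cube with sides ]s/2, s[ lies in the ball, and on it
   the kernel |v_1|^p is at least (s/2)^p. *)
pose s : R := m.+1%:R^-1.
have s0 : 0 < s by rewrite invr_gt0.
pose A (i : 'I_m) : set R := `]s / 2, s[%classic.
have mA i : measurable (A i) by exact: measurable_itv.
pose Q := [set x : 'rV[R]_m | forall i, A i (x 0 i)].
have mQ : measurable Q by exact: measurable_box mA.
have QB : Q `<=` B.
  move=> x Qx; rewrite /B /= /dotp.
  apply: (@le_lt_trans _ _ (\sum_(i < m) s * s)).
    apply: ler_sum => i _; have := Qx i; rewrite /A/= in_itv/= => /andP[x1 x2].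
    have x0 : 0 <= x 0 i by apply: ltW; apply: lt_trans x1; rewrite divr_gt0.
    by rewrite ler_pM// ltW.
  rewrite sumr_const card_ord -mulr_natl.
  have ms : m%:R * s < 1 by rewrite /s ltr_pdivrMr// mul1r ltr_nat.
  have sl1 : s <= 1 by rewrite /s invf_le1// ler1n.
  rewrite mulrA; apply: le_lt_trans ms.
  by rewrite -[leRHS]mulr1 ler_wpM2l// mulr_ge0// ltW.
have Qpos : (0 < mu Q)%E.
  have -> : mu Q = _ := lebesgue_rV_box mA.
  rewrite (eq_bigr (fun=> (s / 2)%:E)) => [|i _].
    by rewrite prodEFin lte_fin prodr_gt0// => i _; rewrite divr_gt0.
  rewrite lebesgue_measure_itv/= lte_fin ifT; last by lra.
  by rewrite -EFinB; congr EFin; lra.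
rewrite -lte_fin -ball_averageE.
apply: (@lt_le_trans _ _ (\int[mu]_(v in Q) ((s / 2) `^ p)%:E)%E).
  rewrite integral_cst// mule_gt0// ?lte_fin ?powR_gt0 ?divr_gt0//.
apply: (@le_trans _ _ (\int[mu]_(v in Q) (ball_kernel e1 e1 v)%:E)%E).
  apply: ge0_le_integral => //.
  - by move=> x _; rewrite lee_fin powR_ge0.
  - by apply/measurable_EFinP; apply: measurable_funTS; exact: measurable_ball_kernel.
  - move=> x Qx; rewrite lee_fin kE; apply: ge0_ler_powR.
    + by apply: ltW; apply: lt_trans p1.
    + by rewrite nnegrE divr_ge0// ltW.
    + by rewrite nnegrE.
    + have := Qx (Ordinal m0); rewrite /A/= in_itv/= => /andP[x1 x2].
      by apply: le_trans (ler_norm _); exact: ltW.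
apply: ge0_subset_integral => //.
- exact: measurable_unit_ball.
- by apply/measurable_EFinP; apply: measurable_funTS; exact: measurable_ball_kernel.
- by move=> x _; rewrite lee_fin kE powR_ge0.
Qed.

(** Integrating the hypothesis over v in the ball and exchanging the integrals leaves the ball
    average inside, which [ball_averageP] evaluates as a positive multiple of the p-Laplacian
    integrand. The kernel has no sign, so Fubini's theorem is applied, with integrability from the
    bound K and the finite measures. *)
Lemma integral_pairing_ge0 n (D : set 'rV[R]_n) (U V : 'rV[R]_n -> 'rV[R]_m)
    (K : R) : measurable D -> (lebesgue_rV R n D < +oo)%E ->
  (forall j, measurable_fun D (fun g => U g 0 j)) ->
  (forall j, measurable_fun D (fun g => V g 0 j)) ->
  (forall g, D g -> enorm (U g) <= K) -> (forall g, D g -> enorm (V g) <= K) ->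
  (forall v, (0 <= \int[lebesgue_rV R n]_(g in D)
    (dpow p (dotp (U g) v) * dotp (V g) v)%:E)%E) ->
  (0 <= \int[lebesgue_rV R n]_(g in D)
    (enorm (U g) `^ (p - 2) * dotp (U g) (V g))%:E)%E.
Proof.
move=> mD fD mU mV UK VK pos; set nu := lebesgue_rV R n in fD pos *.
have mB := measurable_unit_ball.
have mDB : measurable (D `*` B) by exact: measurableX.
pose kern (z : 'rV[R]_n * 'rV[R]_m) : R := ball_kernel (U z.1) (V z.1) z.2.
have mdot (W : 'rV[R]_n -> 'rV[R]_m) : (forall j, measurable_fun D (fun g => W g 0 j)) ->
    measurable_fun (D `*` B) (fun z : 'rV[R]_n * 'rV[R]_m => dotp (W z.1) z.2).
  move=> mW; apply: measurable_sum => j; apply: measurable_funM.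
    apply: (@measurable_comp _ _ _ _ _ _ D (fun g => W g 0 j) (D `*` B) fst) => //.
      by move=> _ [z [zD _] <-].
    exact: measurable_funTS.
  apply: measurable_funTS.
  exact: (measurableT_comp (measurable_mx_coord _ _) measurable_snd).
have mkern : measurable_fun (D `*` B) kern.
  apply: measurable_funM; last exact: mdot.
  by apply: (measurableT_comp (measurable_dpow p)); exact: mdot.
have kernK z : (D `*` B) z -> `|kern z| <= K `^ (p - 1) * K.
  move=> [Dz Bz]; apply: le_trans (ball_kernel_bounded _ _ Bz) _.
  apply: ler_pM; rewrite ?powR_ge0 ?enorm_ge0 ?VK//.
  apply: ge0_ler_powR; rewrite ?subr_ge0 ?(ltW p1) ?nnegrE ?enorm_ge0 ?UK//.
  by apply: le_trans (UK _ Dz); exact: enorm_ge0.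
have ik : (nu \x mu)%E.-integrable (D `*` B) (EFin \o kern).
  apply: measurable_bounded_integrable => //.
    rewrite /= product_measure1E// lte_mul_pinfty//.
    by rewrite ge0_fin_numE.
    exact: lebesgue_rV_unit_ball_lty.
  exists (K `^ (p - 1) * K); split; first exact: num_real.
  by move=> y ly z DBz /=; apply: le_trans (ltW ly); exact: kernK.
pose F := (EFin \o kern) \_ (D `*` B).
have iF : (nu \x mu)%E.-integrable setT F by exact: (iffLR (integrable_mkcond _ mDB)).
have fub := Fubini iF.
have innerv v : (0 <= \int[nu]_g F (g, v))%E.
  have [Bv|nBv] := pselect (B v).
    have := pos v; rewrite integral_mkcond; congr (_ <= _)%E; apply: eq_integral => g _.
    by rewrite /F !patchE in_setX (mem_set Bv) andbT.
  rewrite integral0_eq// => g _; rewrite /F patchE in_setX.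
  by rewrite (memNset nBv) andbF.
set c := ball_average e1 e1; have c0 : 0 < c := ball_average_gt0.
pose X g := enorm (U g) `^ (p - 2) * dotp (U g) (V g).
have innerg g : (\int[mu]_v F (g, v))%E = ((EFin \o (fun g => c * X g)) \_ D) g.
  rewrite patchE; case: ifPn => Dg.
    rewrite /= -ball_averageP -ball_averageE [RHS]integral_mkcond.
    by apply: eq_integral => v _; rewrite /F !patchE in_setX Dg.
  by rewrite integral0_eq// => v _; rewrite /F patchE in_setX (negbTE Dg).
have icX : nu.-integrable D (EFin \o (fun g => c * X g)).
  apply: (iffRL (integrable_mkcond _ mD)).
  have := integrable_fubini_F iF; apply: eq_integrable => // g _.
  by rewrite /fubini_F innerg.
have icX0 : (0 <= \int[nu]_(g in D) (c * X g)%:E)%E.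
  rewrite integral_mkcond.
  under eq_integral do rewrite -innerg.
  by rewrite fub; apply: integral_ge0.
have -> : (\int[nu]_(g in D) (X g)%:E = \int[nu]_(g in D) (c^-1%:E * (c * X g)%:E))%E.
  by apply: eq_integral => g _; rewrite -EFinM mulKf// gt_eqF.
by rewrite (integralZl mD icX) mule_ge0// lee_fin invr_ge0 ltW.
Qed.

End ball_average.

Lemma cvg_sum_seq (R : realType) (I : Type) (s : seq I) (F : I -> nat -> R) (l : I -> R) :
  (forall j, F j @ \oo --> l j) ->
  (fun i => \sum_(j <- s) F j i) @ \oo --> \sum_(j <- s) l j.
Proof.
move=> Fl; elim: s => [|j s IH].
  by rewrite big_nil; under eq_fun do rewrite big_nil; exact: cvg_cst.
rewrite big_cons; under eq_fun do rewrite big_cons.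
exact: cvgD.
Qed.

(** * Smooth functions with compact support *)

Section smooth_functions.
Context {R : realType} {n : nat}.
Implicit Types (f : 'rV[R]_n -> R) (g w Z x y : 'rV[R]_n).

Lemma is_derive_line f Z x (t : R) : derivable f (x + t *: Z) Z ->
  is_derive t 1 (fun s => f (x + s *: Z)) ('D_Z f (x + t *: Z)).
Proof.
have E : (fun h : R => h^-1 *: (((fun s => f (x + s *: Z)) \o shift t) (h *: 1) - f (x + t *: Z))) =
    (fun h => h^-1 *: ((f \o shift (x + t *: Z)) (h *: Z) - f (x + t *: Z))).
  apply/funext => h /=; congr (_ *: (f _ - _)).
  by rewrite /shift/= scaler1 scalerDl addrCA.
move=> df; split; first by rewrite /derivable E.
by rewrite /derive E.
Qed.

Lemma mean_value (phi dphi : R -> R) (w : R) :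
  (forall t : R, is_derive t 1 phi (dphi t)) ->
  exists2 c, `|c| <= `|w| & phi w - phi 0 = w * dphi c.
Proof.
move=> dphiE.
have cphi : continuous phi.
  by move=> t; apply: differentiable_continuous; apply/derivable1_diffP; exact: ex_derive.
have [w0|/ltW w0] := leP 0 w.
  have [c] := @MVT_segment R phi dphi 0 w w0 (fun t _ => dphiE t) (continuous_subspaceT cphi).
  rewrite in_itv/= subr0 => /andP[c0 cw] ->; exists c; last by rewrite mulrC.
  by rewrite !ger0_norm.
have [c] := @MVT_segment R phi dphi w 0 w0 (fun t _ => dphiE t) (continuous_subspaceT cphi).
rewrite in_itv/= sub0r => /andP[wc c0] H; exists c.
  by rewrite !ler0_norm// lerN2.
by rewrite -opprB H; ring.
Qed.

(** [smooth] speaks only of coordinate partials. Going from g to g + w one coordinate at a time uses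
    only one-dimensional mean values, at points that stay in the box spanned by w around g. *)
Lemma telescoping_mean_value f g w :
  (forall i x, derivable f x (delta_mx 0 i)) ->
  exists xi : 'I_n -> 'rV[R]_n, (forall i j, `|xi i 0 j - g 0 j| <= `|w 0 j|) /\
    f (g + w) - f g = \sum_i w 0 i * partial i f (xi i).
Proof.
move=> df.
pose tr (s : seq 'I_n) : 'rV[R]_n := \row_j (if j \in s then w 0 j else 0).
suff H s : uniq s -> exists xi : 'I_n -> 'rV[R]_n,
    (forall i j, `|xi i 0 j - g 0 j| <= `|w 0 j|) /\
    f (g + tr s) - f g = \sum_(i <- s) w 0 i * partial i f (xi i).
  have [xi [xi1 xi2]] := H (enum 'I_n) (enum_uniq _).
  exists xi; split => //; rewrite -[w in LHS](_ : tr (enum 'I_n) = w).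
    by rewrite xi2 big_enum.
  by apply/rowP => j; rewrite mxE mem_enum.
elim: s => [_|i s IH /= /andP[si /IH[xi [xi1 xi2]]]].
  exists (fun=> g); split; first by move=> i j; rewrite subrr normr0.
  rewrite big_nil (_ : tr _ = 0) ?addr0 ?subrr//.
  by apply/rowP => j; rewrite !mxE.
have trE : tr (i :: s) = tr s + w 0 i *: delta_mx 0 i.
  apply/rowP => j; rewrite !mxE inE; case: eqVneq => [->|ji] /=.
    by rewrite (negbTE si) mulr1 add0r.
  by rewrite mulr0 addr0.
have [c cw cE] := @mean_value _ _ (w 0 i)
  (fun t => is_derive_line (df i (g + tr s + t *: delta_mx 0 i))).
exists (fun j => if j == i then g + tr s + c *: delta_mx 0 i else xi j); split.
  move=> i' j; case: ifPn => // _.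
  rewrite (_ : _ - g 0 j = (if j \in s then w 0 j else 0) + c * (j == i)%:R); last first.
    by rewrite !mxE eqxx /=; ring.
  have [->|ji] := eqVneq j i; first by rewrite (negbTE si) add0r mulr1.
  by rewrite mulr0 addr0; case: ifPn => // _; rewrite normr0.
rewrite big_cons eqxx trE addrA.
have -> : f (g + tr s + w 0 i *: delta_mx 0 i) - f g =
    (f (g + tr s + w 0 i *: delta_mx 0 i) - f (g + tr s)) + (f (g + tr s) - f g).
  by rewrite addrA subrK.
congr (_ + _); first by move: cE; rewrite scale0r addr0.
rewrite xi2; apply: eq_big_seq => j js; case: ifPn => // /eqP ji.
by rewrite -ji js in si.
Qed.

Lemma continuous_compact_support_bounded f (K : set 'rV[R]_n) :
  continuous f -> compact K -> (forall x, ~ K x -> f x = 0) ->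
  exists2 C, 0 <= C & forall x, `|f x| <= C.
Proof.
move=> cf cK f0.
have [M [_ HM]] : bounded_set (f @` K).
  by apply: (@compact_bounded R R^o); apply: continuous_compact => //; exact: continuous_subspaceT.
exists (`|M| + 1) => [|x]; first by rewrite addr_ge0.
have [Kx|/f0 ->] := pselect (K x); last by rewrite normr0 addr_ge0.
by apply: (HM (`|M| + 1)); [rewrite ltr_pwDr// ler_norm|exists x].
Qed.

Lemma smooth_continuous f : smooth f -> continuous f.
Proof. by move=> /(_ [::])[]. Qed.

Lemma smooth_derivable f i x : smooth f -> derivable f x (delta_mx 0 i).
Proof. by move=> /(_ [::])[_]; exact. Qed.

Lemma smooth_partial_continuous f i : smooth f -> continuous (partial i f).
Proof. by move=> /(_ [:: i])[]. Qed.

Section compact_support.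
Context {Omega : set 'rV[R]_n} {f : 'rV[R]_n -> R}.
Hypothesis cf : Ccinfty Omega f.
Let K := closure [set x | f x != 0].

Lemma partial_out_support i x : ~ K x -> partial i f x = 0.
Proof.
move=> nKx; have oK : open (~` K) by apply: closed_openC; exact: closed_closure.
have [e e0 eK] := open_enorm oK nKx.
have f0 y : ~ K y -> f y = 0.
  by move=> nKy; apply/eqP; apply: contrapT => /negP fy; apply: nKy; exact: subset_closure.
apply/cvg_lim => //.
apply: cvg_near_cst.
near=> h; rewrite /= (f0 x nKx) subr0 f0 ?scaler0//.
apply: eK; rewrite /shift/= opprD addrCA subrr addr0 enormN enormZ enorm_delta mulr1.
near: h; apply: dnbhs0_lt => //.
Unshelve. all: by end_near. Qed.

Lemma Ccinfty_bounded : exists2 C, 0 <= C & forall x, `|f x| <= C.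
Proof.
have [sf cK _] := cf; apply: (continuous_compact_support_bounded (smooth_continuous sf) cK).
by move=> x nKx; apply/eqP; apply: contrapT => /negP fx; apply: nKx; exact: subset_closure.
Qed.

Lemma partial_bounded i : exists2 C, 0 <= C & forall x, `|partial i f x| <= C.
Proof.
have [sf cK _] := cf.
apply: (continuous_compact_support_bounded (smooth_partial_continuous (i := i) sf) cK).
by move=> x; exact: partial_out_support.
Qed.

Lemma Ccinfty_lipschitz : exists2 C, 0 <= C &
  forall x y, `|f x - f y| <= C * enorm (x - y).
Proof.
have [sf _ _] := cf.
have /choice[C HC] : forall i, exists C, 0 <= C /\ forall x, `|partial i f x| <= C.
  by move=> i; have [C C0 HC] := partial_bounded i; exists C.
exists (\sum_i C i) => [|x y]; first by apply: sumr_ge0 => i _; exact: (HC i).1.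
have [xi [_]] := telescoping_mean_value y (x - y) (fun i z => smooth_derivable sf).
rewrite (addrC y) subrK => ->; apply: le_trans (ler_norm_sum _ _ _) _.
rewrite mulr_suml; apply: ler_sum => i _; rewrite normrM mulrC.
by rewrite ler_pM// ?(HC i).2// coord_le_enorm.
Qed.

(** The intermediate points of the telescoping sum converge to x with t, and the partials are
    continuous. *)
Lemma Ccinfty_slope_cvg x Z (t : nat -> R) : (forall i, 0 < t i) ->
  t @ \oo --> 0 ->
  (f (x + t i *: Z) - f x) / t i @[i --> \oo] --> \sum_j Z 0 j * partial j f x.
Proof.
move=> t0 tl; have [sf _ _] := cf.
have /choice[xi HX] : forall i, exists xi : 'I_n -> 'rV[R]_n,
    (forall a j, `|xi a 0 j - x 0 j| <= `|(t i *: Z) 0 j|) /\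
    f (x + t i *: Z) - f x = \sum_j (t i *: Z) 0 j * partial j f (xi j).
  by move=> i; exact: (telescoping_mean_value _ _ (fun i z => smooth_derivable sf)).
have -> : (fun i => (f (x + t i *: Z) - f x) / t i) =
    (fun i => \sum_j Z 0 j * partial j f (xi i j)).
  apply/funext => i; rewrite (HX i).2 mulr_suml; apply: eq_bigr => j _.
  by rewrite mxE; field; exact: lt0r_neq0.
apply: cvg_sum_seq => j; apply: cvgMr.
apply: (@cvg_comp _ _ _ (fun i => xi i j) (partial j f) \oo (nbhs x)); last first.
  exact: smooth_partial_continuous.
apply/cvgrPdist_le => e e0; near=> i.
apply: (@le_trans _ _ (t i * `|Z|)).
  rewrite [leLHS]mx_normrE; apply: bigmax_le => [|[a b] _].
    by rewrite mulr_ge0// ltW.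
  rewrite (ord1 a) !mxE distrC; apply: le_trans ((HX i).1 j b) _.
  by rewrite mxE normrM gtr0_norm// ler_wpM2l ?coord_le_norm// ltW.
near: i; have : (fun i => t i * `|Z|) @ \oo --> 0.
  by rewrite -(mul0r `|Z|); exact: cvgMl.
by move/(cvgr_le 0); apply.
Unshelve. all: by end_near. Qed.

(** d attains on the compact support a minimum, which is positive because the support lies in Omega.
    This keeps the negative powers of d bounded and short backward flows inside Omega. *)
Lemma support_dist_boundary : (0 < n)%N -> open Omega -> bounded_set Omega ->
  Omega !=set0 ->
  exists2 delta, 0 < delta & forall x, f x != 0 -> Omega x /\ delta <= dist_boundary Omega x.
Proof.
move=> n0 oO bO neO; have [sf cK KO] := cf.
have fK x : f x != 0 -> K x by move=> fx; exact: subset_closure.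
have [K0|/set0P Kn0] := eqVneq K set0.
  by exists 1 => // x /fK; rewrite K0.
have cd := dist_boundary_continuous n0 oO bO neO.
have [c /set_mem Kc minc] := compact_EVT_min Kn0 cK (continuous_subspaceT cd).
exists (dist_boundary Omega c).
  by apply: dist_boundary_gt0 => //; exact: KO.
by move=> x /fK Kx; split; [exact: KO|exact: minc (mem_set Kx)].
Qed.

End compact_support.

End smooth_functions.

(** * Tangent inequalities, Lipschitz bounds and difference quotients of powers *)

Section power_calculus.
Context {R : realType} {p : R}.
Hypothesis p1 : 1 < p.
Implicit Types (s t c b x : R).

(** Young's inequality for b and c^(p-1) with the conjugate exponent q = p/(p-1), for which
    (c^(p-1))^q = c^p. It says that b^p lies above its tangent at c. *)
Lemma young_tangent b c : 0 <= b -> 0 <= c ->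
  p * c `^ (p - 1) * b <= b `^ p + (p - 1) * c `^ p.
Proof.
move=> b0 c0; have p0 : 0 < p by apply: lt_trans p1.
have pp : 0 < p - 1 by rewrite subr_gt0.
pose q := p / (p - 1); have q0 : 0 < q by rewrite divr_gt0.
have pq : p^-1 + q^-1 = 1 by rewrite /q; field; rewrite !gt_eqF.
have := conjugate_powR b0 (powR_ge0 c (p - 1)) p0 q0 pq.
rewrite -powRrM (_ : (p - 1) * q = p); last by rewrite /q; field; rewrite gt_eqF.
rewrite -(ler_pM2l p0) => /le_trans-/(_ _ (lexx _)) H.
rewrite (_ : p * c `^ (p - 1) * b = p * (b * c `^ (p - 1))); last by ring.
apply: le_trans H _; rewrite le_eqVlt; apply/orP; left; apply/eqP.
by rewrite /q; field; rewrite !gt_eqF.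
Qed.

Lemma norm_powR_tangent s t :
  p * dpow p s * (t - s) <= `|t| `^ p - `|s| `^ p.
Proof.
have p0 : 0 < p by apply: lt_trans p1.
rewrite mulrBr -[X in _ - X]mulrA (dpow_mulr p1).
have := young_tangent (normr_ge0 t) (normr_ge0 s).
have : p * dpow p s * t <= p * `|s| `^ (p - 1) * `|t|.
  rewrite -[leLHS]mulrA -[leRHS]mulrA ler_pM2l//; apply: le_trans (ler_norm _) _.
  by rewrite normrM normr_dpow.
lra.
Qed.

Lemma norm_powR_lipschitz s t M : `|s| <= M -> `|t| <= M ->
  `| `|t| `^ p - `|s| `^ p| <= p * M `^ (p - 1) * `|t - s|.
Proof.
have p0 : 0 < p by apply: lt_trans p1.
have H x y : `|y| <= M -> `|x| `^ p - `|y| `^ p >= - (p * M `^ (p - 1) * `|x - y|).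
  move=> yM; apply: le_trans (norm_powR_tangent y x); rewrite lerNl -mulNr -mulrN.
  rewrite -!mulrA ler_pM2l//; apply: le_trans (ler_norm _) _.
  by rewrite normrM normrN ler_pM//; exact: dpow_bounded.
move=> sM tM; rewrite ler_norml H//= -opprB lerNl distrC.
exact: H.
Qed.

Lemma dpow_continuous : continuous (dpow p : R -> R).
Proof.
have pp : 0 < p - 1 by rewrite subr_gt0.
have Hpos s : 0 < s -> {for s, continuous (dpow p : R -> R)}.
  move=> s0; have : {for s, continuous (@powR R ^~ (p - 1) : R -> R)}.
    apply: differentiable_continuous; apply/derivable1_diffP.
    by apply: derivable_powR; rewrite in_itv/= andbT.
  rewrite /prop_for /continuous_at dpow_ge0E ?(ltW s0)//.
  apply: cvg_trans; apply: near_eq_cvg; near=> y.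
  by rewrite dpow_ge0E// ltW//; near: y; exact: lt_nbhsr.
move=> s; have [s0|s0|->] := ltgtP s 0; [|exact: Hpos|].
  have cN : {for s, continuous ((dpow p : R -> R) \o -%R)}.
    apply: continuous_comp; first exact: oppr_continuous.
    by apply: Hpos; rewrite oppr_gt0.
  have -> : (dpow p : R -> R) = (fun y => - (dpow p \o -%R) y).
    by apply/funext => y /=; rewrite dpowN opprK.
  exact: cvgN.
rewrite /continuous_at dpow0; apply/(@cvgrPdist_le _ _ _ (nbhs (0 : R)) _ (dpow p)) => e e0.
(* This radius solves r^(p-1) = e, the modulus of continuity of [dpow] at 0. *)
have r0 : 0 < e `^ ((p - 1)^-1) by rewrite powR_gt0.
near=> y; rewrite sub0r normrN normr_dpow//.
have yr : `|y| <= e `^ ((p - 1)^-1) by near: y; exact: (@nbhs0_le _ R^o).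
apply: (@le_trans _ _ ((e `^ ((p - 1)^-1)) `^ (p - 1))).
  by apply: ge0_ler_powR; rewrite ?nnegrE// ?(ltW pp) ?(ltW r0).
by rewrite -powRrM mulVf ?gt_eqF// powRr1// ltW.
Unshelve. all: by end_near. Qed.

(** The tangent inequality at x bounds the quotient from below and the one at u_i bounds it from
    above; both bounds have the stated limit by continuity of [dpow]. *)
Lemma norm_powR_slope_cvg (u t : nat -> R) x l : (forall i, 0 < t i) ->
  u @ \oo --> x -> (u i - x) / t i @[i --> \oo] --> l ->
  (`|u i| `^ p - `|x| `^ p) / t i @[i --> \oo] --> p * dpow p x * l.
Proof.
move=> t0 ux ul.
apply: (@squeeze_cvgr _ _ _ _ (fun i => p * dpow p x * ((u i - x) / t i))
  (fun i => p * dpow p (u i) * ((u i - x) / t i))).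
- apply: nearW => i; apply/andP; split.
    by rewrite mulrA ler_pM2r ?invr_gt0// norm_powR_tangent.
  rewrite mulrA ler_pM2r ?invr_gt0//; have := norm_powR_tangent (u i) x; lra.
- exact: cvgMr.
- apply: cvgM => //; apply: cvgMr.
  by apply: continuous_cvg => //; exact: dpow_continuous.
Qed.

Lemma powR_mean_value a s t : 0 < s -> 0 < t ->
  exists c, [/\ Num.min s t <= c, `|c - s| <= `|t - s| &
    t `^ a - s `^ a = a * c `^ (a - 1) * (t - s)].
Proof.
have H x y : 0 < x -> x <= y -> exists2 c, x <= c <= y &
    y `^ a - x `^ a = a * c `^ (a - 1) * (y - x).
  move=> x0 xy.
  have dP c : 0 < c -> is_derive c 1 (@powR R ^~ a) (a * c `^ (a - 1)).
    exact: is_derive1_powR.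
  have [|||c cxy ->] := @MVT_segment R (@powR R ^~ a) (fun c => a * c `^ (a - 1)) x y.
  - by [].
  - by move=> c; rewrite in_itv/= => /andP[xc _]; apply: dP; exact: lt_trans xc.
  - apply: continuous_in_subspaceT => c; rewrite inE/= in_itv/= => /andP[xc _].
    apply: differentiable_continuous; apply/derivable1_diffP.
    by apply: ex_derive; apply: dP; exact: lt_le_trans xc.
  - by exists c => //; move: cxy; rewrite in_itv.
move=> s0 t0; have [st|/ltW ts] := leP s t.
  have [c /andP[sc ct] E] := H s t s0 st; exists c; split => //.
  by rewrite !ger0_norm ?subr_ge0// lerD2r.
have [c /andP[tc cs] E] := H t s t0 ts; exists c; split => //.
  by rewrite !ler0_norm ?subr_le0// !opprB lerD2l lerN2.
by rewrite -opprB E; ring.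
Qed.

(** For a <= 1 the power c^(a-1) decreases in c, so on [delta, +oo[ the derivative is largest in
    modulus at delta. *)
Lemma powR_lipschitz a s t delta : a <= 1 -> 0 < delta -> delta <= s -> delta <= t ->
  `|t `^ a - s `^ a| <= `|a| * delta `^ (a - 1) * `|t - s|.
Proof.
move=> a1 d0 ds dt; have s0 := lt_le_trans d0 ds; have t0 := lt_le_trans d0 dt.
have [c [cm _ ->]] := powR_mean_value a s0 t0.
have dc : delta <= c by apply: le_trans cm; rewrite le_min ds.
rewrite !normrM ler_wpM2r// ler_wpM2l// ger0_norm ?powR_ge0//.
have E r : r `^ (a - 1) = (r `^ (1 - a))^-1 by rewrite -powRN opprB.
rewrite !E.
have H r : 0 < r -> 0 < r `^ (1 - a) by move=> r0; rewrite powR_gt0.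
rewrite lef_pV2 ?posrE ?H//; last exact: lt_le_trans dc.
apply: ge0_ler_powR; rewrite ?subr_ge0 ?nnegrE//; first exact: ltW.
by apply: ltW; exact: lt_le_trans dc.
Qed.

Lemma powR_slope_cvg a (u t : nat -> R) x l : 0 < x -> (forall i, 0 < u i) ->
  u @ \oo --> x -> (u i - x) / t i @[i --> \oo] --> l ->
  (u i `^ a - x `^ a) / t i @[i --> \oo] --> a * x `^ (a - 1) * l.
Proof.
move=> x0 u0 ux ul.
have /choice[c Hc] : forall i, exists c, [/\ Num.min x (u i) <= c,
    `|c - x| <= `|u i - x| & u i `^ a - x `^ a = a * c `^ (a - 1) * (u i - x)].
  by move=> i; exact: powR_mean_value.
have -> : (fun i => (u i `^ a - x `^ a) / t i) =
    (fun i => a * c i `^ (a - 1) * ((u i - x) / t i)).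
  by apply/funext => i; have [_ _ ->] := Hc i; rewrite mulrA.
apply: cvgM => //; apply: cvgMr.
have cp : {for x, continuous (@powR R ^~ (a - 1))}.
  apply: differentiable_continuous; apply/derivable1_diffP.
  by apply: derivable_powR; rewrite in_itv/= andbT.
have cx : c @ \oo --> x.
  apply/cvgrPdist_le => e e0; near=> i; have [_ cx _] := Hc i.
  rewrite distrC; apply: le_trans cx _; rewrite distrC; near: i.
  by move/cvgrPdist_le : ux; apply.
exact: (continuous_cvg _ cp cx).
Unshelve. all: by end_near. Qed.

End power_calculus.

Lemma max_nonexpansive (R : realType) (a x y : R) :
  `|Num.max a x - Num.max a y| <= `|x - y|.
Proof.
have xy := ler_norm (x - y); have := ler_norm (y - x); rewrite distrC => yx.
rewrite ler_norml; case: (leP a x) => ax; case: (leP a y) => ay;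
  by apply/andP; split; lra.
Qed.

Lemma restrict_in {R : realType} {T : Type} (D : set T) (f : T -> R) x :
  D x -> (f \_ D) x = f x.
Proof. by move=> Dx; rewrite patchE mem_set. Qed.

Lemma restrict_out {R : realType} {T : Type} (D : set T) (f : T -> R) x :
  ~ D x -> (f \_ D) x = 0.
Proof. by move=> Dx; rewrite patchE memNset. Qed.

(** * Left and right axis derivatives of d agree almost everywhere *)

Section convex_domain.
Context {R : realType} {n : nat} {Omega : set 'rV[R]_n}.
Hypotheses (n0 : (0 < n)%N) (oO : open Omega) (cO : convex_set Omega).
Hypotheses (bO : bounded_set Omega) (neO : Omega !=set0).
Local Notation d := (dist_boundary Omega).
Local Notation mu := (lebesgue_rV R n).
Implicit Types (g x Z : 'rV[R]_n) (t : R).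

Lemma domain_measurable : measurable Omega.
Proof. exact: open_measurable_rV. Qed.

Lemma dist_concave_on : concave_on Omega d.
Proof. by move=> g h l Og Oh l01; exact: dist_boundary_concave. Qed.

Lemma dist_nonexpansive : nonexpansive d.
Proof. by move=> g h; exact: dist_boundary_lipschitz. Qed.

Lemma segment_in_domain g Z t : Omega g -> `|t| * enorm Z < d g -> Omega (g + t *: Z).
Proof.
move=> Og tZ; apply: (ball_dist_boundary oO Og).
by rewrite addrAC subrr add0r enormZ.
Qed.

(** Concavity along the axis gives b <= c between the right derivative b and the left derivative c,
    and c(x) <= b(x - t e). So [ae_no_jump] applies with the translations by t e, which preserve the
    measure. *)
Lemma ae_axis_odd i : {ae mu, forall g, Omega g ->
  rderive d g (delta_mx 0 i) = - rderive d g (- delta_mx 0 i)}.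
Proof.
set e : 'rV[R]_n := delta_mx 0 i.
have e1 : enorm e = 1 by exact: enorm_delta.
have mO := domain_measurable.
have fO : (mu Omega < +oo)%E by exact: lebesgue_rV_domain_lty.
have mrd Z : measurable_fun Omega (fun g => rderive d g Z).
  exact: (measurable_rderive oO dist_concave_on dist_nonexpansive (measurable_cst Z)).
pose b := (fun g => rderive d g e) \_ Omega.
pose c := (fun g => - rderive d g (- e)) \_ Omega.
(* These Lipschitz cutoffs exhaust Omega: each point of Omega has d > 1/(N+1) for some N, and
   countably many null sets are discarded. *)
pose phi (N : nat) g := Num.max 0 (dist_inside Omega g - N.+1%:R^-1).
suff H N : {ae mu, forall x, phi N x != 0 -> b x = c x}.
  have := ae_foralln H; apply: filterS => g Hg Og.
  have dg0 : 0 < d g by exact: dist_boundary_gt0.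
  have [N Nd] : exists N, N.+1%:R^-1 < d g.
    have := @cvg_harmonic R; move/cvgrPdist_lt => /(_ (d g) dg0)[N _ /(_ N)] /=.
    rewrite leqnn => /(_ isT) H'; exists N.
    by move: H'; rewrite sub0r normrN ger0_norm.
  have : b g = c g.
    apply: (Hg N); rewrite gt_eqF// lt_max; apply/orP; right.
    by rewrite dist_insideE// subr_gt0.
  by rewrite /b /c !restrict_in.
(* The index shift makes every step shorter than 1/(N+1), so the backward translation from a point
   where phi_N does not vanish stays in Omega. *)
pose t j : R := harmonic (j + N.+1)%N.
have t0 j : 0 < t j by exact: harmonic_gt0.
have tN j : t j < N.+1%:R^-1.
  by rewrite /t /harmonic/= ltf_pV2 ?posrE// ltr_nat ltnS leq_addl.
have phi_in x : phi N x != 0 -> Omega x /\ N.+1%:R^-1 < d x.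
  rewrite /phi => px.
  have : N.+1%:R^-1 < dist_inside Omega x.
    rewrite -subr_gt0 ltNge; apply/negP => le0; move: px.
    by rewrite max_l// eqxx.
  move=> Nx; have Ox : Omega x.
    by apply: dist_inside_gt0; apply: lt_trans Nx; rewrite invr_gt0.
  by rewrite -(dist_insideE Ox).
have [M HM] := dist_inside_bounded n0 oO bO neO.
have lip x y : `|phi N x - phi N y| <= enorm (x - y).
  apply: le_trans (dist_inside_lipschitz n0 oO bO neO x y).
  apply: le_trans (max_nonexpansive _ _ _) _; rewrite le_eqVlt; apply/orP; left.
  by apply/eqP; congr `|_|; ring.
apply: (@ae_no_jump _ _ Omega mO fO (fun j x => x + t j *: e)
  (fun j x => x + - (t j *: e)) t b c (phi N) 1 (`|M|)).
- by move=> j; exact: rV_preserving_translate.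
- by move=> j; exact: rV_preserving_translate.
- by move=> j x; rewrite addrK.
- by have := @cvg_harmonic R; rewrite -(cvg_shiftn N.+1).
- exact: (iffLR (measurable_restrictT _ mO)) (mrd e).
- apply: (iffLR (measurable_restrictT _ mO)).
  by apply: measurableT_comp => //; exact: mrd.
- apply: continuous_measurable_rV; first exact: openT.
  move=> x _; apply: (@lipschitz_continuous_rV _ _ (phi N) 1) => y z.
  by rewrite mul1r.
- move=> x; have [Ox|nOx] := pselect (Omega x); last first.
    by rewrite /b restrict_out// normr0.
  by rewrite /b restrict_in// -e1; exact: (rderive_le_enorm oO dist_concave_on dist_nonexpansive).
- move=> x; have di0 := dist_inside_ge0 n0 oO bO neO x.
  rewrite ger0_norm ?le_max ?lexx// ge_max normr_ge0/=.
  apply: le_trans (ler_norm M); apply: le_trans (HM x).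
  by rewrite gerBl.
- by move=> x; exact: restrict_out.
- move=> x nOx; rewrite /phi dist_inside_out// sub0r max_l//.
- by move=> x; rewrite le_max lexx.
- move=> x; have [Ox|nOx] := pselect (Omega x); last by rewrite /b /c !restrict_out.
  by rewrite /b /c !restrict_in//; exact: (rderive_le_left oO dist_concave_on dist_nonexpansive).
- move=> j x /phi_in[Ox dx].
  have OT : Omega (x - t j *: e).
    rewrite -scaleNr; apply: segment_in_domain => //.
    by rewrite e1 mulr1 normrN gtr0_norm//; exact: lt_trans dx.
  rewrite /b /c !restrict_in//.
  have xE : x = (x - t j *: e) + t j *: e by rewrite subrK.
  rewrite [X in - rderive _ X _]xE.
  by apply: (left_le_rderive oO dist_concave_on dist_nonexpansive) => //; rewrite subrK.
- move=> j x _; apply: le_trans (lip _ _) _.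
  by rewrite addrAC subrr add0r enormZ e1 mulr1 gtr0_norm.
Qed.

Lemma ae_axes_odd : {ae mu, forall g, Omega g ->
  forall i, rderive d g (delta_mx 0 i) = - rderive d g (- delta_mx 0 i)}.
Proof.
have : {ae mu, forall g, forall i, Omega g ->
    rderive d g (delta_mx 0 i) = - rderive d g (- delta_mx 0 i)}.
  apply: filter_forall => i; exact: ae_axis_odd.
by apply: filterS => g H Og i; exact: H.
Qed.

Lemma partial_dist_le1 i g : Omega g -> `|partial i d g| <= 1.
Proof.
move=> Og; rewrite (partial_rderive oO dist_concave_on dist_nonexpansive)//.
case: ifP => _; last by rewrite normr0.
by rewrite -(enorm_delta i); exact: (rderive_le_enorm oO dist_concave_on dist_nonexpansive).
Qed.

End convex_domain.

Lemma stratified2_dim_gt0 (R : realType) (m k : nat) (G : stratified2 R m k) :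
  (0 < m + k)%N.
Proof. by rewrite addn_gt0 (layer2_nontrivial G) orbT. Qed.

(** V_2 is nonzero and spanned by brackets of V_1, so V_1 cannot be zero. This provides the unit
    vector e1 of the ball average. *)
Lemma stratified2_layer1_gt0 (R : realType) (m k : nat) (G : stratified2 R m k) :
  (0 < m)%N.
Proof.
rewrite lt0n; apply/eqP => m0; subst m.
have [i] : 'I_k by exact: (Ordinal (layer2_nontrivial G)).
move=> ik; pose z : 'rV[R]_(0 + k) := row_mx 0 (delta_mx 0 (Ordinal ik)).
have : bracket_span (bracket G) (@layer1 R 0 k) (@layer1 R 0 k) z.
  by rewrite bracket_11 /layer2 /= row_mxKl.
have V0 (x : 'rV[R]_(0 + k)) : layer1 x -> x = 0.
  move=> x1; rewrite -[x]hsubmxK x1 (_ : lsubmx x = 0) ?row_mx0//.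
  by apply/rowP => -[].
move=> [N [x [y [xy zE]]]].
have : z 0 (rshift 0 (Ordinal ik)) = 0.
  rewrite zE big1 ?mxE// => a _; rewrite (V0 _ (xy a).1).
  have := bracket_linearl G (y a) 1 0 0; rewrite scaler0 addr0 scale1r.
  by move/eqP; rewrite -subr_eq0 opprD addrA subrr sub0r oppr_eq0 => /eqP.
by move=> /eqP; rewrite row_mxEr mxE !eqxx oner_eq0.
Qed.

(** * Superharmonicity *)

Section horizontal_test.
Context {R : realType} {m k : nat} (G : stratified2 R m k).
Local Notation n := (m + k)%N.
Context {Omega : set 'rV[R]_n} {p : R}.
Hypotheses (p1 : 1 < p) (oO : open Omega) (cO : convex_set Omega).
Hypotheses (bO : bounded_set Omega) (neO : Omega !=set0).
Local Notation d := (dist_boundary Omega).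
Local Notation mu := (lebesgue_rV R n).
Implicit Types (g x : 'rV[R]_n) (v : 'rV[R]_m).

Let n0 : (0 < n)%N := stratified2_dim_gt0 G.
Let mO : measurable Omega := domain_measurable oO.
Let fO : (mu Omega < +oo)%E := lebesgue_rV_domain_lty oO bO.
Let cd : concave_on Omega d := dist_concave_on n0 oO cO bO neO.
Let ld : nonexpansive d := dist_nonexpansive n0 oO bO neO.

Lemma horizontal_field_domain v :
  exists2 K, 0 < K & forall g, Omega g -> enorm (horizontal_field G v g) <= K.
Proof.
have [M [_ HM]] := domain_bounded_coord bO.
have [K HK] := horizontal_field_bounded G v HM.
exists (`|K| + 1) => [|g Og]; first by rewrite ltr_wpDl.
by apply: le_trans (HK g Og) _; apply: le_trans (ler_norm K) _; rewrite lerDl.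
Qed.

Lemma measurable_rderive_flow v :
  measurable_fun Omega (fun g => rderive d g (horizontal_field G v g)).
Proof. by apply: (measurable_rderive oO cd ld); exact: measurable_horizontal_field. Qed.

(* The function dpow p (X_v d) is nonincreasing along the flow of X_v, because d
   is concave along its integral curves, which are straight lines. *)
Lemma flow_test_ge0 v (phi psi : 'rV[R]_n -> R) (delta C M : R) :
  0 < delta -> 0 <= C ->
  (forall x, phi x != 0 -> Omega x /\ delta <= d x) ->
  (forall x, 0 <= phi x <= M) ->
  (forall x y, `|phi x - phi y| <= C * enorm (x - y)) ->
  (forall x (t : nat -> R), Omega x -> (forall i, 0 < t i) -> t @ \oo --> 0 ->
    (phi (x + t i *: horizontal_field G v x) - phi x) / t i @[i --> \oo] --> psi x) ->
  (0 <= \int[mu]_(g in Omega)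
     (dpow p (rderive d g (horizontal_field G v g)) * psi g)%:E)%E.
Proof.
move=> delta0 C0 phi_in phiM lip cpsi.
have [K K0 HK] := horizontal_field_domain v.
(* The steps start so late that t_i K < delta: flowing backwards from a point where phi does not
   vanish does not leave Omega. *)
have [N HN] : exists N, @harmonic R N < delta / K.
  have := @cvg_harmonic R; move/cvgrPdist_lt => /(_ (delta / K)).
  rewrite divr_gt0// => /(_ isT)[N _ /(_ N)] /= /(_ (leqnn _)) H; exists N.
  by move: H; rewrite sub0r normrN ger0_norm.
pose t i : R := harmonic (i + N)%N.
have t0 i : 0 < t i by exact: harmonic_gt0.
have tK i : t i * K < delta.
  rewrite -ltr_pdivlMr//; apply: le_lt_trans HN.
  by rewrite /t /harmonic/= lef_pV2 ?posrE// ler_nat ltnS leq_addl.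
have tl : t @ \oo --> 0 by have := @cvg_harmonic R; rewrite -(cvg_shiftn N).
pose b := (fun g => dpow p (rderive d g (horizontal_field G v g))) \_ Omega.
have -> : (\int[mu]_(g in Omega) (dpow p (rderive d g (horizontal_field G v g)) * psi g)%:E =
    \int[mu]_(g in Omega) (b g * psi g)%:E)%E.
  by apply: eq_integral => g /set_mem Og; rewrite /b restrict_in.
have flow_in i x : phi x != 0 -> Omega (horizontal_flow G v (- t i) x).
  move=> /phi_in[Ox dx]; apply: segment_in_domain => //.
  rewrite normrN gtr0_norm//; apply: lt_le_trans dx; apply: le_lt_trans (tK i).
  by rewrite ler_wpM2l ?HK// ltW.
apply: (integral_flow_derivative_ge0 mO fO (T := fun i => horizontal_flow G v (t i))
  (T' := fun i => horizontal_flow G v (- t i)) (t := t) (phi := phi) (B := K `^ (p - 1))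
  (M := M) (L := C * K)).
- by move=> i; exact: rV_preserving_flow.
- by move=> i; exact: rV_preserving_flow.
- by move=> i; exact: horizontal_flowK.
- exact: t0.
- apply: (iffLR (measurable_restrictT _ mO)).
  by apply: (measurableT_comp (measurable_dpow p)); exact: measurable_rderive_flow.
- apply: continuous_measurable_rV; first exact: openT.
  by move=> x _; exact: lipschitz_continuous_rV lip _.
- move=> x; have [Ox|nOx] := pselect (Omega x); last first.
    by rewrite /b restrict_out// normr0 powR_ge0.
  rewrite /b restrict_in//; apply: dpow_bounded => //; apply: le_trans (HK x Ox).
  exact: (rderive_le_enorm oO cd ld).
- by move=> x; have /andP[? ?] := phiM x; rewrite ger0_norm.
- by move=> x; exact: restrict_out.
- by move=> x nOx; apply/eqP/negPn/negP => /phi_in[].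
- by move=> x; have /andP[] := phiM x.
- move=> i x px; have [Ox _] := phi_in x px; have OT := flow_in i x px.
  rewrite /b !restrict_in//; apply: dpow_nondecreasing => //.
  set y := horizontal_flow G v (- t i) x in OT *.
  (* The field is the same at both points, so the derivatives compared are in one fixed direction
     along one line. *)
  have Zy : horizontal_field G v y = horizontal_field G v x by exact: horizontal_field_flow.
  have xE : x = y + t i *: horizontal_field G v x.
    by rewrite /y /horizontal_flow scaleNr subrK.
  rewrite Zy {1}xE; apply: (rderive_nonincreasing oO cd ld) => //.
  by rewrite -xE.
- move=> i x Ox; apply: le_trans (lip _ _) _.
  rewrite /horizontal_flow addrAC subrr add0r enormZ gtr0_norm// -mulrA ler_wpM2l//.
  by rewrite mulrC ler_wpM2r ?HK// ltW.
- by move=> x Ox; exact: cpsi.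
Qed.

Lemma gradH_domain_bounded f :
  (forall q, exists C, forall g, Omega g -> `|partial q f g| <= C) ->
  exists K, forall g, Omega g -> enorm (gradH G f g) <= K.
Proof.
move=> /choice[C HC].
have /choice[K HK] : forall j : 'I_m, exists K, 0 < K /\ forall g, Omega g ->
    enorm (horizontal_field G (delta_mx 0 j) g) <= K.
  by move=> j; have [K K0 HK] := horizontal_field_domain (delta_mx 0 j); exists K.
exists (\sum_j \sum_q K j * C q) => g Og; apply: le_trans (enorm_le_sum _) _.
apply: ler_sum => j _; rewrite -dotp_delta gradH_dotp.
apply: le_trans (ler_norm_sum _ _ _) _; apply: ler_sum => q _.
rewrite normrM ler_pM ?HC//.
by apply: le_trans (coord_le_enorm _ _) _; exact: (HK j).2.
Qed.

Lemma measurable_gradH f j : (forall q, measurable_fun Omega (partial q f)) ->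
  measurable_fun Omega (fun g => gradH G f g 0 j).
Proof.
move=> mf.
have -> : (fun g => gradH G f g 0 j) = (fun g => partial (lshift k j) f g +
    2^-1 * \sum_(i < k) structure_act G i g 0 j * partial (rshift m i) f g).
  by apply/funext => g; rewrite mxE.
apply: measurable_funD => //; apply: measurable_funM => //.
apply: measurable_sum => i; apply: measurable_funM => //.
by apply: measurable_funTS; exact: measurable_structure_act.
Qed.

Lemma gradH_dist_bounded : exists K, forall g, Omega g -> enorm (gradH G d g) <= K.
Proof.
by apply: gradH_domain_bounded => q; exists 1 => g Og; exact: partial_dist_le1.
Qed.

Lemma measurable_gradH_dist j : measurable_fun Omega (fun g => gradH G d g 0 j).
Proof.
by apply: measurable_gradH => q; exact: (measurable_partial_concave oO cd ld).
Qed.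

(** Where left and right axis derivatives agree, [rderive] is linear in the direction and [partial]
    is a genuine derivative, so both sides are the same combination of partials. *)
Lemma rderive_gradH_dist v g : Omega g ->
  (forall i, rderive d g (delta_mx 0 i) = - rderive d g (- delta_mx 0 i)) ->
  rderive d g (horizontal_field G v g) = dotp (gradH G d g) v.
Proof.
move=> Og odd; rewrite (rderive_linear oO cd ld)// gradH_dotp.
apply: eq_bigr => q _; congr (_ * _).
by rewrite (partial_rderive oO cd ld)// -odd eqxx.
Qed.

(** The common source of (ii) and (iii). The slope limit psi is asked for everywhere, so that
    dominated convergence can be used, but it has to be the linear form of a vector field V only
    where the axis derivatives of d agree. This admits test functions built from d itself. *)
Lemma pLaplacian_test_ge0 (phi : 'rV[R]_n -> R) (psi : 'rV[R]_m -> 'rV[R]_n -> R)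
    (V : 'rV[R]_n -> 'rV[R]_m) (delta C M K : R) :
  0 < delta -> 0 <= C ->
  (forall x, phi x != 0 -> Omega x /\ delta <= d x) ->
  (forall x, 0 <= phi x <= M) ->
  (forall x y, `|phi x - phi y| <= C * enorm (x - y)) ->
  (forall v x (t : nat -> R), Omega x -> (forall i, 0 < t i) -> t @ \oo --> 0 ->
    (phi (x + t i *: horizontal_field G v x) - phi x) / t i @[i --> \oo] --> psi v x) ->
  (forall v, measurable_fun Omega (psi v)) ->
  (forall j, measurable_fun Omega (fun g => V g 0 j)) ->
  (forall g, Omega g -> enorm (V g) <= K) ->
  (forall v g, Omega g ->
    (forall i, rderive d g (delta_mx 0 i) = - rderive d g (- delta_mx 0 i)) ->
    psi v g = dotp (V g) v) ->
  (0 <= \int[mu]_(g in Omega)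
    (enorm (gradH G d g) `^ (p - 2) * dotp (gradH G d g) (V g))%:E)%E.
Proof.
move=> delta0 C0 phi_in phiM lip cpsi mpsi mV VK psiE.
have [K' HK'] := gradH_dist_bounded.
have m0 := stratified2_layer1_gt0 G.
have mdot (W : 'rV[R]_n -> 'rV[R]_m) v : (forall j, measurable_fun Omega (fun g => W g 0 j)) ->
    measurable_fun Omega (fun g => dotp (W g) v).
  by move=> mW; apply: measurable_sum => j; apply: measurable_funM.
apply: (integral_pairing_ge0 m0 p1 (K := Num.max K K') mO fO) => //.
- exact: measurable_gradH_dist.
- by move=> g Og; rewrite le_max HK' ?orbT.
- by move=> g Og; rewrite le_max VK.
move=> v.
rewrite (_ : (\int[mu]_(g in Omega) _)%E = (\int[mu]_(g in Omega)
     (dpow p (rderive d g (horizontal_field G v g)) * psi v g)%:E)%E).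
  exact: (flow_test_ge0 delta0 C0 phi_in phiM lip (cpsi v)).
apply: ae_eq_integral => //.
- apply/measurable_EFinP; apply: measurable_funM; last exact: mdot.
  apply: (measurableT_comp (measurable_dpow p)); apply: mdot; exact: measurable_gradH_dist.
- apply/measurable_EFinP; apply: measurable_funM => //.
  by apply: (measurableT_comp (measurable_dpow p)); exact: measurable_rderive_flow.
have := ae_axes_odd n0 oO cO bO neO; apply: filterS => g odd Og /=.
by rewrite (rderive_gradH_dist v Og (odd Og)) psiE//; exact: odd.
Qed.

End horizontal_test.

(** * Scalar inequality and difference quotients for the Hardy estimate *)

Lemma mulr_sub_split {R : pzRingType} (a b c e : R) :
  a * b - c * e = (a - c) * b + c * (b - e).
Proof. by rewrite mulrBl mulrBr addrA subrK. Qed.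

Lemma slope_mulr {R : fieldType} (a b c e t : R) :
  (a * b - c * e) / t = (a - c) / t * b + c * ((b - e) / t).
Proof. by rewrite mulr_sub_split; ring. Qed.

Lemma powR_le_neg {R : realType} (a s delta : R) : a <= 0 -> 0 < delta -> delta <= s ->
  s `^ a <= delta `^ a.
Proof.
move=> a0 d0 ds; have s0 := lt_le_trans d0 ds.
have E r : r `^ a = (r `^ (- a))^-1 by rewrite -powRN opprK.
rewrite !E lef_pV2 ?posrE ?powR_gt0//.
by apply: ge0_ler_powR; rewrite ?oppr_ge0 ?nnegrE// ltW.
Qed.

(* Convexity of s |-> s^p at s = (p - 1) / p * e w / D, with e = |grad d|,
   w = |u|, D = d, b = |grad u|. *)
Lemma hardy_scalar {R : realType} (p e w D b y : R) : 1 < p ->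
  0 <= e -> 0 <= w -> 0 < D -> 0 <= b -> y <= w `^ (p - 1) * (e * b) ->
  ((p - 1) / p) `^ p * (e `^ p / D `^ p * w `^ p) +
  ((p - 1) / p) `^ (p - 1) * (e `^ (p - 2) *
    (p * D `^ (1 - p) * y - (p - 1) * w `^ p * D `^ (- p) * e ^+ 2)) <= b `^ p.
Proof.
move=> p1 e0 w0 D0 b0 yb; have p0 : 0 < p by apply: lt_trans p1.
have pp : 0 < p - 1 by rewrite subr_gt0.
have [kap kapE] : exists kap, kap = (p - 1) / p by exists ((p - 1) / p).
rewrite -kapE; have kap0 : 0 < kap by rewrite kapE divr_gt0.
have [a aE] : exists a, a = e * w / D by exists (e * w / D).
have ew0 : 0 <= e * w by exact: mulr_ge0.
have a0 : 0 <= a by rewrite aE divr_ge0// ltW.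
have iD0 : 0 <= D^-1 by rewrite invr_ge0 ltW.
have powa q : a `^ q = e `^ q * w `^ q * D `^ (- q).
  rewrite aE powRM// powRM//; congr (_ * _).
  by rewrite -powR_inv1 ?(ltW D0)// -powRrM mulN1r.
have e1 : e `^ (p - 1) = e `^ (p - 2) * e.
  by rewrite -(dpow_ge0E p1 e0) /dpow ger0_norm.
have e2 : e `^ p = e `^ (p - 2) * e ^+ 2.
  by rewrite -(mulr_powRB1 e0 p0) e1; ring.
(* In terms of a = e w / D the tested quantity is bounded by p a^(p-1) b - (p-1) a^p. *)
have T_le : e `^ (p - 2) *
    (p * D `^ (1 - p) * y - (p - 1) * w `^ p * D `^ (- p) * e ^+ 2) <=
    p * a `^ (p - 1) * b - (p - 1) * a `^ p.
  rewrite !powa opprB e1 e2.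
  have : e `^ (p - 2) * (p * D `^ (1 - p)) * y <=
      e `^ (p - 2) * (p * D `^ (1 - p)) * (w `^ (p - 1) * (e * b)).
    by rewrite ler_wpM2l// !mulr_ge0 ?powR_ge0// ltW.
  by rewrite -subr_ge0 => H; rewrite -subr_ge0; apply: le_trans H _;
    rewrite le_eqVlt; apply/orP; left; apply/eqP; ring.
have -> : e `^ p / D `^ p * w `^ p = a `^ p by rewrite powa powRN; ring.
apply: le_trans (lerD (lexx _) (ler_wpM2l (powR_ge0 kap (p - 1)) T_le)) _.
have := young_tangent p1 b0 (mulr_ge0 (ltW kap0) a0).
have E q : (kap * a) `^ q = kap `^ q * a `^ q by rewrite powRM// ltW.
rewrite !E -lerBlDr => H; apply: le_trans H.
rewrite -(mulr_powRB1 (ltW kap0) p0).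
move: (kap `^ (p - 1)) (a `^ p) (a `^ (p - 1)) => A B C.
(* Young's inequality was applied at c = kap a. The a^p terms that remain cancel exactly when p kap
   = p - 1, which is the origin of the Hardy constant. *)
have kp : p - 1 = p * kap by rewrite kapE; field; rewrite gt_eqF.
rewrite -subr_ge0 (_ : _ - _ = A * B * (p - 1 - p * kap)); last by ring.
by rewrite kp subrr mulr0.
Qed.

Lemma lipschitz_segment_cvg {R : realType} {n : nat} (f : 'rV[R]_n -> R) (C : R)
    (x Z : 'rV[R]_n) (t : nat -> R) :
  (forall y z, `|f y - f z| <= C * enorm (y - z)) -> t @ \oo --> 0 ->
  f (x + t i *: Z) @[i --> \oo] --> f x.
Proof.
move=> lip tl; apply/cvgrPdist_le => e e0; near=> i.
rewrite distrC; apply: le_trans (lip _ _) _.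
rewrite addrAC subrr add0r enormZ mulrCA.
near: i; have : (fun i => `|t i| * (C * enorm Z)) @ \oo --> 0.
  by rewrite -(mul0r (C * enorm Z)) -(@normr0 R R); apply: cvgMl; exact: cvg_norm.
by move/(cvgr_le 0); apply.
Unshelve. all: by end_near. Qed.

(** * Hardy inequality *)

Section hardy.
Context {R : realType} {m k : nat} (G : stratified2 R m k).
Local Notation n := (m + k)%N.
Context {Omega : set 'rV[R]_n} {p : R}.
Hypotheses (p1 : 1 < p) (oO : open Omega) (cO : convex_set Omega).
Hypotheses (bO : bounded_set Omega) (neO : Omega !=set0).
Local Notation d := (dist_boundary Omega).
Local Notation mu := (lebesgue_rV R n).
Implicit Types (g x : 'rV[R]_n) (v : 'rV[R]_m).

Let n0 : (0 < n)%N := stratified2_dim_gt0 G.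
Let mO : measurable Omega := domain_measurable oO.
Let fO : (mu Omega < +oo)%E := lebesgue_rV_domain_lty oO bO.
Let cd : concave_on Omega d := dist_concave_on n0 oO cO bO neO.
Let ld : nonexpansive d := dist_nonexpansive n0 oO bO neO.

Lemma measurable_gradH_Ccinfty u j : Ccinfty Omega u ->
  measurable_fun Omega (fun g => gradH G u g 0 j).
Proof.
move=> cu; have [su _ _] := cu; apply: measurable_gradH => q; apply: measurable_funTS.
apply: continuous_measurable_rV; first exact: openT.
by move=> x _; exact: smooth_partial_continuous.
Qed.

Lemma gradH_Ccinfty_bounded u : Ccinfty Omega u ->
  exists K, forall g, Omega g -> enorm (gradH G u g) <= K.
Proof.
move=> cu; apply: (gradH_domain_bounded G bO) => q.
by have [C _ HC] := partial_bounded cu q; exists C => g _.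
Qed.

Lemma Ccinfty_horizontal_slope u v x (t : nat -> R) : Ccinfty Omega u ->
  (forall i, 0 < t i) -> t @ \oo --> 0 ->
  (u (x + t i *: horizontal_field G v x) - u x) / t i @[i --> \oo] -->
    dotp (gradH G u x) v.
Proof. by move=> cu t0 tl; rewrite gradH_dotp; exact: (Ccinfty_slope_cvg cu). Qed.

Lemma measurable_dotp_on (D : set 'rV[R]_n) (U V : 'rV[R]_n -> 'rV[R]_m) :
  (forall j, measurable_fun D (fun g => U g 0 j)) ->
  (forall j, measurable_fun D (fun g => V g 0 j)) ->
  measurable_fun D (fun g => dotp (U g) (V g)).
Proof. by move=> mU mV; apply: measurable_sum => j; exact: measurable_funM. Qed.

Lemma measurable_enorm_powR (D : set 'rV[R]_n) (U : 'rV[R]_n -> 'rV[R]_m) (a : R) :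
  (forall j, measurable_fun D (fun g => U g 0 j)) ->
  measurable_fun D (fun g => enorm (U g) `^ a).
Proof.
move=> mU; have -> : (fun g => enorm (U g) `^ a) = (fun g => (dotp (U g) (U g) `^ (2^-1)) `^ a).
  by apply/funext => g; rewrite powR12_sqrt// dotp_ge0.
do 2 apply: (measurableT_comp (measurable_powR _)).
exact: measurable_dotp_on.
Qed.

Lemma dist_pLaplacianH_le0 : pLaplacianH_le0 G p Omega d.
Proof.
move=> phi cphi phi0.
have [delta delta0 phi_in] := support_dist_boundary cphi n0 oO bO neO.
have [M M0 HM] := Ccinfty_bounded cphi.
have [C C0 HC] := Ccinfty_lipschitz cphi.
have [K HK] := gradH_Ccinfty_bounded cphi.
apply: (pLaplacian_test_ge0 p1 oO cO bO neO (phi := phi)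
  (psi := fun v g => dotp (gradH G phi g) v) (delta := delta) (C := C) (M := M) (K := K)) => //.
- by move=> x; rewrite phi0/=; apply: le_trans (ler_norm _) (HM x).
- by move=> v x t Ox t0 tl; exact: Ccinfty_horizontal_slope.
- move=> v; apply: measurable_dotp_on => j; last exact: measurable_cst.
  exact: measurable_gradH_Ccinfty.
- by move=> j; exact: measurable_gradH_Ccinfty.
Qed.

Section hardy_test.
Context {u : 'rV[R]_n -> R}.
Hypothesis cu : Ccinfty Omega u.

(* The horizontal gradient of |u|^p / d^(p-1). *)
Definition hardy_field g : 'rV[R]_m :=
  (p * dpow p (u g) * d g `^ (1 - p)) *: gradH G u g -
  ((p - 1) * `|u g| `^ p * d g `^ (- p)) *: gradH G d g.

(** Where u does not vanish, d is at least delta and its negative powers are bounded; where u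
    vanishes, so do both coefficients. *)
Lemma hardy_field_bounded :
  exists K, forall g, Omega g -> enorm (hardy_field g) <= K.
Proof.
have p0 : 0 < p by apply: lt_trans p1.
have [delta delta0 u_in] := support_dist_boundary cu n0 oO bO neO.
have [M M0 HM] := Ccinfty_bounded cu.
have [K HK] := gradH_Ccinfty_bounded cu.
have [K' HK'] := gradH_dist_bounded G oO cO bO neO.
exists (p * M `^ (p - 1) * delta `^ (1 - p) * K +
  (p - 1) * M `^ p * delta `^ (- p) * K') => g Og.
have K0 : 0 <= K by apply: le_trans (HK g Og); exact: enorm_ge0.
have K'0 : 0 <= K' by apply: le_trans (HK' g Og); exact: enorm_ge0.
have [ug|ug] := eqVneq (u g) 0.
  rewrite /hardy_field ug dpow0 normr0 powR0 ?gt_eqF//.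
  rewrite !mulr0 !mul0r !scale0r subr0 enorm0.
  by rewrite addr_ge0// !mulr_ge0 ?powR_ge0 ?subr_ge0// ltW.
have [_ dg] := u_in g ug.
rewrite /hardy_field; move: (dpow p (u g)) (dpow_bounded p1 (HM g)) => w wM.
apply: le_trans (ler_enormD _ _) _; rewrite enormN !enormZ; apply: lerD.
  rewrite ler_pM ?enorm_ge0 ?HK// !normrM (gtr0_norm p0).
  rewrite ler_pM ?mulr_ge0 ?(ltW p0)//.
    by rewrite ler_wpM2l ?(ltW p0).
  by rewrite ger0_norm ?powR_ge0// powR_le_neg// subr_le0 ltW.
have pp : 0 <= p - 1 by rewrite subr_ge0 ltW.
rewrite ler_pM ?enorm_ge0 ?HK'// !normrM (ger0_norm pp).
rewrite ler_pM ?mulr_ge0//.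
  rewrite ler_wpM2l// ger0_norm ?powR_ge0//.
  by apply: ge0_ler_powR; rewrite ?nnegrE// ltW.
by rewrite ger0_norm ?powR_ge0// powR_le_neg// oppr_le0 ltW.
Qed.

Lemma measurable_dist_powR a : measurable_fun Omega (fun g => d g `^ a).
Proof.
apply: (measurableT_comp (measurable_powR _)); apply: continuous_measurable_rV => // x _.
exact: dist_boundary_continuous.
Qed.

Lemma measurable_Ccinfty : measurable_fun Omega u.
Proof.
have [su _ _] := cu; apply: continuous_measurable_rV => // x _.
exact: smooth_continuous.
Qed.

Lemma measurable_hardy_field j : measurable_fun Omega (fun g => hardy_field g 0 j).
Proof.
rewrite (_ : (fun g => hardy_field g 0 j) = fun g =>
    p * dpow p (u g) * d g `^ (1 - p) * gradH G u g 0 j -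
    (p - 1) * `|u g| `^ p * d g `^ (- p) * gradH G d g 0 j); last first.
  apply/funext => g; rewrite /hardy_field.
  have E (a b : R) (x y : 'rV[R]_m) : (a *: x - b *: y) 0 j = a * x 0 j - b * y 0 j.
    by rewrite !mxE.
  exact: E.
apply: measurable_funB; apply: measurable_funM.
- apply: measurable_funM; last exact: measurable_dist_powR.
  apply: measurable_funM => //.
  by apply: (measurableT_comp (measurable_dpow p)); exact: measurable_Ccinfty.
- exact: measurable_gradH_Ccinfty.
- apply: measurable_funM; last exact: measurable_dist_powR.
  apply: measurable_funM => //; apply: (measurableT_comp (measurable_powR _)).
  by apply: measurableT_comp => //; exact: measurable_Ccinfty.
- exact: measurable_gradH_dist.
Qed.

(** The test function is |u|^p D^(1-p), with D bounded below by a positive constant and equal to d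
    where u does not vanish. It coincides with |u|^p / d^(p-1) in Omega and is Lipschitz on the
    whole space. *)
Lemma hardy_field_test_ge0 : (0 <= \int[mu]_(g in Omega)
  (enorm (gradH G d g) `^ (p - 2) * dotp (gradH G d g) (hardy_field g))%:E)%E.
Proof.
have p0 : 0 < p by apply: lt_trans p1.
have [delta delta0 u_in] := support_dist_boundary cu n0 oO bO neO.
have [M M0 HM] := Ccinfty_bounded cu.
have [C C0 HC] := Ccinfty_lipschitz cu.
have [K HK] := hardy_field_bounded.
(* Strictly less than delta, so that D = d also near each point where u does not vanish and not only
   at that point. *)
pose eta := delta / 2; have eta0 : 0 < eta by rewrite divr_gt0.
pose D g := Num.max eta (dist_inside Omega g).
have Deta g : eta <= D g by rewrite le_max lexx.
have D0 g : 0 < D g by exact: lt_le_trans (Deta g).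
have Dlip x y : `|D x - D y| <= 1 * enorm (x - y).
  rewrite mul1r; apply: le_trans (max_nonexpansive _ _ _) _.
  exact: dist_inside_lipschitz n0 oO bO neO x y.
pose P g := `|u g| `^ p; pose Q g := D g `^ (1 - p).
have P0 g : 0 <= P g by exact: powR_ge0.
have PM g : P g <= M `^ p by apply: ge0_ler_powR; rewrite ?nnegrE// ltW.
have Q0 g : 0 <= Q g by exact: powR_ge0.
have p1' : 1 - p <= 0 by rewrite subr_le0 ltW.
have QM g : Q g <= eta `^ (1 - p) by exact: powR_le_neg.
pose CP := p * M `^ (p - 1) * C.
pose CQ := `|1 - p| * eta `^ (1 - p - 1).
have CP0 : 0 <= CP by rewrite !mulr_ge0 ?powR_ge0 ?(ltW p0).
have CQ0 : 0 <= CQ by rewrite mulr_ge0 ?powR_ge0.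
have Plip x y : `|P x - P y| <= CP * enorm (x - y).
  apply: le_trans (norm_powR_lipschitz p1 (HM y) (HM x)) _.
  by rewrite -[leRHS]mulrA ler_wpM2l ?HC// mulr_ge0 ?powR_ge0 ?(ltW p0).
have Qlip x y : `|Q x - Q y| <= CQ * enorm (x - y).
  apply: le_trans (powR_lipschitz (le_trans p1' ler01) eta0 (Deta y) (Deta x)) _.
  by rewrite ler_wpM2l//; apply: le_trans (Dlip x y) _; rewrite mul1r.
apply: (pLaplacian_test_ge0 p1 oO cO bO neO (phi := fun g => P g * Q g)
  (psi := fun v g => p * dpow p (u g) * d g `^ (1 - p) * dotp (gradH G u g) v -
    (p - 1) * `|u g| `^ p * d g `^ (- p) * rderive d g (horizontal_field G v g))
  (V := hardy_field) (delta := delta) (C := CP * eta `^ (1 - p) + M `^ p * CQ)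
  (M := M `^ p * eta `^ (1 - p)) (K := K)) => //.
- by rewrite addr_ge0// mulr_ge0 ?powR_ge0.
- move=> x PQ; apply: u_in; apply: contraNneq PQ => ux.
  by rewrite /P ux normr0 powR0 ?mul0r// gt_eqF.
- by move=> x; rewrite mulr_ge0//= ler_pM.
- move=> x y; rewrite mulr_sub_split; apply: le_trans (ler_normD _ _) _; rewrite !normrM mulrDl; apply: lerD.
    rewrite [leRHS]mulrAC; apply: ler_pM; [exact: normr_ge0..|exact: Plip|].
    by rewrite ger0_norm.
  rewrite -[leRHS]mulrA; apply: ler_pM; [exact: normr_ge0..| |exact: Qlip].
  by rewrite ger0_norm.
- move=> v x t Ox t0 tl; set Z := horizontal_field G v x.
  have ul : u (x + t i *: Z) @[i --> \oo] --> u x by exact: lipschitz_segment_cvg HC tl.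
  have us := Ccinfty_horizontal_slope (v := v) (x := x) cu t0 tl.
  have Ps := norm_powR_slope_cvg p1 t0 ul us.
  have Ql : Q (x + t i *: Z) @[i --> \oo] --> Q x by exact: lipschitz_segment_cvg Qlip tl.
  rewrite (_ : (fun i => _) = (fun i => (P (x + t i *: Z) - P x) / t i *
      Q (x + t i *: Z) + P x * ((Q (x + t i *: Z) - Q x) / t i))); last first.
    by apply/funext => i; exact: slope_mulr.
  (* At a zero of u both P and the limit of its slope vanish, so the quotient tends to 0 although D
     may differ from d there. *)
  have [ux|ux] := eqVneq (u x) 0.
    have Px : P x = 0 by rewrite /P ux normr0 powR0// gt_eqF.
    rewrite Px; under eq_fun do rewrite mul0r addr0.
    rewrite -/(P x) Px ux dpow0 !(mulr0, mul0r) subr0.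
    have PQ : (fun i => (P (x + t i *: Z) - P x) / t i * Q (x + t i *: Z)) @ \oo -->
        p * dpow p (u x) * dotp (gradH G u x) v * Q x by exact: cvgM Ps Ql.
    by move: PQ; rewrite Px ux dpow0 mulr0 !mul0r.
  have [_ dx] := u_in x ux.
  have Dx : D x = d x.
    rewrite /D dist_insideE// max_r//; apply: le_trans dx.
    by rewrite /eta; lra.
  have Dl : D (x + t i *: Z) @[i --> \oo] --> d x.
    by rewrite -Dx; exact: lipschitz_segment_cvg Dlip tl.
  (* Since d(x) > eta, the points x + t_i Z eventually satisfy D = d, so the quotients of D are
     slopes of d and tend to its right derivative. *)
  have Ds : (D (x + t i *: Z) - d x) / t i @[i --> \oo] --> rderive d x Z.
    apply: cvg_trans (rderive_sequence (Z := Z) oO cd ld Ox t0 tl).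
    have xd : dist_inside Omega x = d x by rewrite dist_insideE.
    have il : dist_inside Omega (x + t i *: Z) @[i --> \oo] --> dist_inside Omega x.
      apply: (lipschitz_segment_cvg (C := 1)) tl => y z; rewrite mul1r.
      exact: dist_inside_lipschitz n0 oO bO neO y z.
    have eta_lt : eta < dist_inside Omega x.
      by rewrite xd; apply: lt_le_trans dx; rewrite /eta; lra.
    apply: near_eq_cvg; near=> i; rewrite /slope.
    have big : eta < dist_inside Omega (x + t i *: Z).
      by near: i; exact: (cvgr_gt _ il).
    have Oi : Omega (x + t i *: Z) by apply: dist_inside_gt0; exact: lt_trans big.
    by rewrite /D max_r ?(ltW big)// dist_insideE.
  have d0 : 0 < d x by exact: lt_le_trans dx.
  have Qs := powR_slope_cvg (a := 1 - p) d0 (fun i => D0 (x + t i *: Z)) Dl Ds.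
  rewrite (_ : _ - _ = p * dpow p (u x) * dotp (gradH G u x) v * Q x +
      P x * ((1 - p) * d x `^ (1 - p - 1) * rderive d x Z)); last first.
    rewrite /Q Dx /P (_ : 1 - p - 1 = - p); last by ring.
    move: (dpow p (u x)) (dotp _ v) (`|u x| `^ p) (rderive d x Z) => r1 r2 r3 r4.
    by move: (d x `^ (1 - p)) (d x `^ (- p)) => r5 r6; ring.
  by apply: cvgD; [exact: cvgM Ps Ql|apply: cvgMr; rewrite /Q Dx].
- move=> v; apply: measurable_funB; apply: measurable_funM.
  + apply: measurable_funM; last exact: measurable_dist_powR.
    apply: measurable_funM => //.
    by apply: (measurableT_comp (measurable_dpow p)); exact: measurable_Ccinfty.
  + apply: measurable_dotp_on => j; last exact: measurable_cst.
    exact: measurable_gradH_Ccinfty.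
  + apply: measurable_funM; last exact: measurable_dist_powR.
    apply: measurable_funM => //; apply: (measurableT_comp (measurable_powR _)).
    by apply: measurableT_comp => //; exact: measurable_Ccinfty.
  + exact: measurable_rderive_flow.
- exact: measurable_hardy_field.
- move=> v g Og odd; rewrite (rderive_gradH_dist G oO cO bO neO v Og odd).
  by rewrite /hardy_field dotpDl dotpNl !dotpZl.
Unshelve. all: by end_near. Qed.

Lemma hardy_pointwise g : Omega g ->
  ((p - 1) / p) `^ p * (enorm (gradH G d g) `^ p / d g `^ p * `|u g| `^ p) +
  ((p - 1) / p) `^ (p - 1) *
    (enorm (gradH G d g) `^ (p - 2) * dotp (gradH G d g) (hardy_field g))
  <= enorm (gradH G u g) `^ p.
Proof.
move=> Og; have d0 : 0 < d g by exact: dist_boundary_gt0.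
have -> : dotp (gradH G d g) (hardy_field g) =
    p * d g `^ (1 - p) * (dpow p (u g) * dotp (gradH G d g) (gradH G u g)) -
    (p - 1) * `|u g| `^ p * d g `^ (- p) * enorm (gradH G d g) ^+ 2.
  rewrite /hardy_field dotpDr dotpNr !dotpZr sqr_enorm.
  by congr (_ - _); rewrite mulrA; congr (_ * _); rewrite mulrAC.
apply: hardy_scalar => //; rewrite ?enorm_ge0//.
rewrite -(normr_dpow p1 (u g)); apply: le_trans (ler_norm _) _.
rewrite normrM; apply: ler_wpM2l (dotp_le_enorm _ _); exact: normr_ge0.
Qed.

Lemma hardy_inequality :
  ((((p - 1) / p) `^ p)%:E *
   \int[mu]_(g in Omega)
     (enorm (gradH G d g) `^ p / d g `^ p * `|u g| `^ p)%:E
   <= \int[mu]_(g in Omega) (enorm (gradH G u g) `^ p)%:E)%E.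
Proof.
have p0 : 0 < p by apply: lt_trans p1.
have mgd j := measurable_gradH_dist G oO cO bO neO j.
have mgu j := measurable_gradH_Ccinfty j cu.
have [K HK] := gradH_Ccinfty_bounded cu.
have [K' HK'] := gradH_dist_bounded G oO cO bO neO.
have [K2 HK2] := hardy_field_bounded.
have ibnd (f : 'rV[R]_n -> R) B : measurable_fun Omega f ->
    (forall g, Omega g -> `|f g| <= B) -> mu.-integrable Omega (EFin \o f).
  move=> mf fB; apply: measurable_bounded_integrable => //; exists B.
  by split; [exact: num_real|move=> y By g Og /=; apply: le_trans (fB g Og) (ltW By)].
pose T g := enorm (gradH G d g) `^ (p - 2) * dotp (gradH G d g) (hardy_field g).
have iT : mu.-integrable Omega (EFin \o T).
  apply: (ibnd _ (K' `^ (p - 1) * K2)).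
    apply: measurable_funM; first exact: measurable_enorm_powR.
    by apply: measurable_dotp_on => // j; exact: measurable_hardy_field.
  move=> g Og; rewrite normrM ger0_norm ?powR_ge0//.
  apply: (@le_trans _ _ (dpow p (enorm (gradH G d g)) * enorm (hardy_field g))).
    rewrite /dpow (ger0_norm (enorm_ge0 (gradH G d g))) -mulrA ler_wpM2l ?powR_ge0//.
    exact: dotp_le_enorm.
  rewrite dpow_ge0E ?enorm_ge0// ler_pM ?powR_ge0 ?enorm_ge0 ?HK2//.
  apply: ge0_ler_powR; rewrite ?nnegrE ?enorm_ge0 ?HK'//.
    by rewrite subr_ge0 ltW.
  by apply: le_trans (HK' g Og); exact: enorm_ge0.
have iu : mu.-integrable Omega (EFin \o (fun g => enorm (gradH G u g) `^ p)).
  apply: (ibnd _ (K `^ p)); first exact: measurable_enorm_powR.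
  move=> g Og; rewrite ger0_norm ?powR_ge0//.
  apply: ge0_ler_powR; rewrite ?nnegrE ?enorm_ge0 ?HK// ?(ltW p0)//.
  by apply: le_trans (HK g Og); exact: enorm_ge0.
set kap := (p - 1) / p.
pose T' g := kap `^ (p - 1) * T g.
have iT' : mu.-integrable Omega (EFin \o T').
  exact: (integrableZl mO (kap `^ (p - 1)) iT).
have T'0 : (0 <= \int[mu]_(g in Omega) (T' g)%:E)%E.
  have -> : (\int[mu]_(g in Omega) (T' g)%:E =
      (kap `^ (p - 1))%:E * \int[mu]_(g in Omega) (T g)%:E)%E.
    by rewrite -(integralZl mO iT).
  by rewrite mule_ge0 ?lee_fin ?powR_ge0//; exact: hardy_field_test_ge0.
pose h g := enorm (gradH G d g) `^ p / d g `^ p * `|u g| `^ p.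
have h0 g : 0 <= h g by rewrite mulr_ge0 ?divr_ge0 ?powR_ge0.
have mh : measurable_fun Omega h.
  apply: measurable_funM.
    apply: measurable_funM; first exact: measurable_enorm_powR.
    have -> : (fun g => (d g `^ p)^-1) = (fun g => d g `^ (- p)).
      by apply/funext => g; rewrite powRN.
    exact: measurable_dist_powR.
  apply: (measurableT_comp (measurable_powR _)).
  by apply: measurableT_comp => //; exact: measurable_Ccinfty.
rewrite -ge0_integralZl_EFin ?powR_ge0//; last 2 first.
- by move=> g _; rewrite lee_fin h0.
- exact/measurable_EFinP.
under eq_integral do rewrite -EFinM.
(* The remainder changes sign, so it is moved to the side of |grad_H u|^p, where both terms are
   integrable; the comparison is then one for nonnegative integrands. *)
apply: (@le_trans _ _ (\int[mu]_(g in Omega) ((enorm (gradH G u g) `^ p)%:E - (T' g)%:E))%E).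
  apply: ge0_le_integral => //.
  - by move=> g _; rewrite lee_fin; apply: mulr_ge0 (h0 g); exact: powR_ge0.
  - by apply/measurable_EFinP; apply: measurable_funM => //; exact: mh.
  - exact: (measurable_int _ (integrableB mO iu iT')).
  - move=> g Og; rewrite -EFinB lee_fin lerBrDr.
    exact: hardy_pointwise.
rewrite (integralB_EFin mO iu iT').
rewrite -[leRHS]sube0; exact: leeB.
Qed.

End hardy_test.

End hardy.

Theorem theoremD (R : realType) (m k : nat) (G : stratified2 R m k)
    (p : R) (Omega : set 'rV[R]_(m + k)) :
  1 < p -> domain Omega -> bounded_set Omega -> convex_set Omega ->
  [/\ weakly_Hconcave G Omega (dist_boundary Omega),
      pLaplacianH_le0 G p Omega (dist_boundary Omega) &
      forall u : 'rV[R]_(m + k) -> R, Ccinfty Omega u ->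
        ((((p - 1) / p) `^ p)%:E *
         \int[lebesgue_rV R (m + k)]_(g in Omega)
           (enorm (gradH G (dist_boundary Omega) g) `^ p
             / dist_boundary Omega g `^ p * `|u g| `^ p)%:E
         <= \int[lebesgue_rV R (m + k)]_(g in Omega)
              (enorm (gradH G u g) `^ p)%:E)%E ].
Proof.
move=> p1 [oO _ neO] bO cO; split.
- apply: concave_weakly_Hconcave.
  exact: (dist_concave_on (stratified2_dim_gt0 G) oO cO bO neO).
- exact: dist_pLaplacianH_le0.
- by move=> u cu; exact: hardy_inequality.
Qed.
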